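(* Let the vertices of an octahedron be labelled by $(ik)=(ki)$, $i\neq k\in\{1,2,3,4\}$, such that opposite vertices carry complementary indices, and let the corresponding points of octahedral point-circle configurations in $\mathbb{R}^4\cong\mathbb{H}$ be denoted by $\Phi_{ik}=\Phi_{ki}$. (i) The points $\Phi_{ik}$ of any generalized Clifford configuration satisfy either $$M(\Phi_{14},\Phi_{12},\Phi_{24},\Phi_{23},\Phi_{34},\Phi_{13})=-1$$ or $$\tilde M(\Phi_{14},\Phi_{12},\Phi_{24},\Phi_{23},\Phi_{34},\Phi_{13})=-1$$ (the ''or'' being inclusive). (ii) Conversely, any six points $\Phi_{ik}$ of an octahedral point-circle configuration which obey either of these two multi-ratio conditions constitute the points of a generalized Clifford configuration.
   Context: $\mathbb{R}^4$ is identified with the quaternions $\mathbb{H}$ via $(a,b,c,d)\leftrightarrow a+b\,\mathbf{i}+c\,\mathbf{j}+d\,\mathbf{k}$. For quaternions $P_1,\dots,P_6$ (with the inverses existing), $$M(P_1,\dots,P_6)=(P_1-P_2)(P_2-P_3)^{-1}(P_3-P_4)(P_4-P_5)^{-1}(P_5-P_6)(P_6-P_1)^{-1},$$ $$\tilde M(P_1,\dots,P_6)=(P_1-P_6)^{-1}(P_6-P_5)(P_5-P_4)^{-1}(P_4-P_3)(P_3-P_2)^{-1}(P_2-P_1).$$ **Octahedral point-circle configuration.** A configuration of six (distinct) points and eight circles in $\mathbb{R}^4$ with the combinatorics of an octahedron: the points correspond to the vertices, the circles to the triangular faces, and a circle passes through a point of the configuration iff the corresponding face contains the corresponding vertex (so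 three points on every circle, four circles through every point). As usual in inversive geometry, straight lines count as circles (through $\infty$). Two vertices are opposite if not joined by an edge; two faces are opposite if disjoint. The opposite point of $P$ and the opposite circle of $S$ are denoted by $P^*$, $S^*$. **Correspondence.** Consider pairs $(S;P)$ of a circle $S$ of the configuration and a point $P$ of the configuration on $S$. If the circles $S_1\ne S_2$ both pass through the points $P_1\neq P_2$ of the configuration (i.e. their faces share the edge $P_1P_2$), then $S_1$ at $P_1$ corresponds to $S_2$ at $P_2$, and $S_2$ at $P_1$ corresponds to $S_1$ at $P_2$. Moreover, $S$ at $P$ corresponds to $S^*$ at $P^*$. The equivalence relation generated by these rules has four classes, each containing exactly one circle at each of the six points. Circles at different points are called corresponding if they are in the same class. **Orientation.** The circles are oriented so that the induced orientations of the faces of the octahedron (given by the cyclic order in which the circle passes through its three points) all agree when viewed from outside, i.e. neighbouring faces induce opposite directions on their common edge. **Angles.** The angle $\angle(S,S')$ of two oriented circles through a point $P$ is the Euclidean angle in $[0,\pi]$ between their tangent vectors at $P$ pointing in the direction of the orientations. **Generalized Clifford configuration.** An octahedral point-circle configuration with points $P_1,\dots,P_6$ such that for any two classes of corresponding circles, with $S_k,S'_k$ denoting their members at $P_k$, the angle $\angle(S_k,S_k')$ is independent of $k=1,\dots,6$. *)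

(* Defs.v *)
From HB Require Import structures.
From mathcomp Require Import all_boot all_order all_algebra.
From mathcomp Require Import all_classical all_reals all_analysis.
Set Implicit Arguments.
Unset Strict Implicit.
Unset Printing Implicit Defensive.
Import Order.TTheory GRing.Theory Num.Theory.
Import numFieldNormedType.Exports.
Local Open Scope classical_set_scope.
Local Open Scope ring_scope.

(** * Quaternions, on the carrier R^4 *)

Section Quaternions.
Context {R : realType}.
Implicit Types p q : 'rV[R]_4.

Definition quat (a b c d : R) : 'rV[R]_4 := \row_i [:: a; b; c; d]`_i.

Definition qone : 'rV[R]_4 := quat 1 0 0 0.

Definition qmul p q : 'rV[R]_4 :=
  let a := p 0 (inord 0) in let b := p 0 (inord 1) in
  let c := p 0 (inord 2) in let d := p 0 (inord 3) in
  let e := q 0 (inord 0) in let f := q 0 (inord 1) in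
  let g := q 0 (inord 2) in let h := q 0 (inord 3) in
  quat (a * e - b * f - c * g - d * h)
       (a * f + b * e + c * h - d * g)
       (a * g - b * h + c * e + d * f)
       (a * h + b * g - c * f + d * e).

Definition qconj p : 'rV[R]_4 :=
  quat (p 0 (inord 0)) (- p 0 (inord 1)) (- p 0 (inord 2)) (- p 0 (inord 3)).

(* Euclidean inner product and norm; the norm `|x| that the library puts on
   row vectors is the sup norm. *)
Definition dot p q : R := \sum_i p 0 i * q 0 i.

Definition enorm p : R := Num.sqrt (dot p p).

(* Equal to 0 when p = 0. *)
Definition qinv p : 'rV[R]_4 := (dot p p)^-1 *: qconj p.

End Quaternions.

Notation "p *q q" := (qmul p q) (at level 40, left associativity) : ring_scope.
Notation "p ^-1q" := (qinv p) (at level 3, left associativity, format "p ^-1q") : ring_scope.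

Definition multiratio {R : realType} (P1 P2 P3 P4 P5 P6 : 'rV[R]_4) :
    'rV[R]_4 :=
  (P1 - P2) *q (P2 - P3)^-1q *q (P3 - P4) *q (P4 - P5)^-1q
            *q (P5 - P6) *q (P6 - P1)^-1q.

Definition multiratio_tilde {R : realType} (P1 P2 P3 P4 P5 P6 : 'rV[R]_4) :
    'rV[R]_4 :=
  (P1 - P6)^-1q *q (P6 - P5) *q (P5 - P4)^-1q *q (P4 - P3)
                *q (P3 - P2)^-1q *q (P2 - P1).

(** * Oriented circles and lines in R^4 *)

(* [OCircle c r u v]: centre c, radius r, in the plane through c spanned by
   the orthonormal pair (u, v), traversed from u towards v.
   [OLine a d]: the line through a, traversed in the direction d. *)
Inductive ocircle (R : realType) : Type :=
| OCircle (c : 'rV[R]_4) (r : R) (u v : 'rV[R]_4) of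
    0 < r & dot u u = 1 & dot v v = 1 & dot u v = 0
| OLine (a d : 'rV[R]_4) of d != 0.

Section Circles.
Context {R : realType}.
Implicit Types (C : ocircle R) (S : set 'rV[R]_4).

Definition param C : R -> 'rV[R]_4 :=
  match C with
  | OCircle c r u v _ _ _ _ =>
      fun s => c + (r * cos s) *: u + (r * sin s) *: v
  | OLine a d _ => fun s => a + s *: d
  end.

Definition carrier C : set 'rV[R]_4 := range (param C).

Definition is_circle S : Prop := exists C, carrier C = S.

(* C passes through x, y, z in this cyclic order; a line closes up through
   the point at infinity. *)
Definition passes C (x y z : 'rV[R]_4) : Prop :=
  exists s1 s2 s3 : R,
    [/\ param C s1 = x, param C s2 = y, param C s3 = z &
        match C with
        | OCircle _ _ _ _ _ _ _ _ => [/\ s1 < s2, s2 < s3 & s3 < s1 + pi *+ 2]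
        | OLine _ _ _ => [\/ s1 < s2 < s3, s2 < s3 < s1 | s3 < s1 < s2]
        end].

(* The velocity of C at x, where x is a point of C: it does not depend on the
   parameter value at which C passes through x. *)
Definition tangent C (x : 'rV[R]_4) : 'rV[R]_4 :=
  xget 0 [set derive1 (param C) s | s in param C @^-1` [set x]].

Definition angle (t t' : 'rV[R]_4) : R := acos (dot t t' / (enorm t * enorm t')).

Definition circle_angle C C' (x : 'rV[R]_4) : R :=
  angle (tangent C x) (tangent C' x).

End Circles.

(** * The octahedron *)

(* The vertex (ik) = (ki), for i < k. *)
Inductive vertex := V12 | V13 | V14 | V23 | V24 | V34.

Definition vertex_code (v : vertex) : nat :=
  match v with
  | V12 => 0 | V13 => 1 | V14 => 2 | V23 => 3 | V24 => 4 | V34 => 5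
  end.

Definition vertex_decode (n : nat) : option vertex :=
  nth None (map Some [:: V12; V13; V14; V23; V24; V34]) n.

Lemma vertex_codeK : pcancel vertex_code vertex_decode.
Proof. by case. Qed.

HB.instance Definition _ := Countable.copy vertex (pcan_type vertex_codeK).

Lemma vertex_enumP : Finite.axiom [:: V12; V13; V14; V23; V24; V34].
Proof. by case. Qed.

HB.instance Definition _ := fintype.isFinite.Build vertex vertex_enumP.

Definition opposite (v : vertex) : vertex :=
  match v with
  | V12 => V34 | V13 => V24 | V14 => V23
  | V34 => V12 | V24 => V13 | V23 => V14
  end.

(* Three vertices which are pairwise joined by an edge, i.e. not opposite. *)
Definition is_face (f : {set vertex}) : bool :=
  (#|f| == 3%N) && [forall v in f, opposite v \notin f].

Definition face : Type := {f : {set vertex} | is_face f}.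

(* [corr (f, v) (g, w)]: the circle of the face f at the point of v
   corresponds to the circle of the face g at the point of w.  Exchanging f
   and g in [corr_edge] gives the other correspondence across an edge. *)
Inductive corr : face * vertex -> face * vertex -> Prop :=
| corr_edge (f g : face) (v w : vertex) :
    f != g -> v != w -> v \in val f -> v \in val g ->
    w \in val f -> w \in val g -> corr (f, v) (g, w)
| corr_opp (f g : face) (v : vertex) :
    v \in val f -> (forall w, w \in val f -> w \notin val g) ->
    corr (f, v) (g, opposite v)
| corr_refl (f : face) (v : vertex) : v \in val f -> corr (f, v) (f, v)
| corr_sym x y : corr x y -> corr y x
| corr_trans x y z : corr x y -> corr y z -> corr x z.

(** * Point-circle configurations *)

Section Configurations.
Context {R : realType}.
Implicit Types (Phi : vertex -> 'rV[R]_4) (S : face -> set 'rV[R]_4)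
  (C : face -> ocircle R).

Definition octahedral_configuration Phi S : Prop :=
  [/\ injective Phi,
      forall f, is_circle (S f) &
      forall f v, S f (Phi v) <-> v \in val f].

(* Neighbouring faces induce opposite directions on their common edge; there
   are two such orientations of the circles of a configuration, which differ
   by the reversal of all circles. *)
Definition coherent Phi C : Prop :=
  forall (f g : face) (v w a b : vertex), f != g ->
    val f = [set v; w; a]%SET -> val g = [set v; w; b]%SET ->
    passes (C f) (Phi v) (Phi w) (Phi a) ->
    passes (C g) (Phi w) (Phi v) (Phi b).

Definition generalized_clifford Phi S : Prop :=
  octahedral_configuration Phi S /\
  exists C : face -> ocircle R,
    [/\ forall f, carrier (C f) = S f,
        coherent Phi C &
        forall (f g f' g' : face) (v w : vertex),
          corr (f, v) (f', w) -> corr (g, v) (g', w) ->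
          circle_angle (C f) (C g) (Phi v) =
          circle_angle (C f') (C g') (Phi w)].

End Configurations.

(* Main.v *)
Require Import Defs.
From HB Require Import structures.
From mathcomp Require Import all_boot all_order all_algebra.
From mathcomp Require Import all_classical all_reals all_analysis.
From mathcomp Require Import ring lra.
Set Implicit Arguments.
Unset Strict Implicit.
Unset Printing Implicit Defensive.
Import Order.TTheory GRing.Theory Num.Theory.
Import numFieldNormedType.Exports.
Local Open Scope ring_scope.

(* The tangent at x of the oriented circle through x, y, z is, up to a positive
   factor, the conjugate of (y - x)^-1 - (z - x)^-1.  Translate Phi_13 to 0 and
   invert: the other points become a, b, a', b', c, the tangents at Phi_13 become
   the sides s_k of the closed quadrilateral a b a' b', and at every other vertex
   the tangents are those of the inverted figure multiplied by fixed quaternions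
   on the left and on the right.  With S = s_0 + s_3 the condition M = -1 reads
   c - a = - s_2 S^-1 s_0, and the condition on the other multi-ratio is its
   mirror image under quaternionic conjugation.

   If M = -1, then at every vertex the tangent of class k has the form p s_k q
   with p, q depending on the vertex only, so all the angles agree.

   Conversely, equality of the angles at 14 and 13 makes the relation between
   the sides s_k hold, suitably scaled, for the tangents at 14.  As the tangents
   of the two circles through 14 and 24 are independent,
   it is the closing relation of the inverted figure at 14, and the two
   quadruples of tangents have proportional Gram matrices.  This and the same
   argument at 12 determine the distances from c to a, b, a', b', hence c up to
   the reflection which exchanges the two multi-ratio conditions. *)

(** * Quaternions *)

(** A separate name for the row vectors, to which the noncommutative ring structure is attached. *)
Definition quaternion (R : realType) := 'rV[R]_4.

Section Coordinates.
Variable R : realType.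
Implicit Types p q r : 'rV[R]_4.

Lemma coord_quat (a b c d : R) :
  [/\ quat a b c d 0 (inord 0) = a, quat a b c d 0 (inord 1) = b,
      quat a b c d 0 (inord 2) = c & quat a b c d 0 (inord 3) = d].
Proof. by rewrite !mxE !inordK. Qed.

Lemma quat0E (a b c d : R) : quat a b c d 0 (inord 0) = a.
Proof. by have [] := coord_quat a b c d. Qed.
Lemma quat1E (a b c d : R) : quat a b c d 0 (inord 1) = b.
Proof. by have [] := coord_quat a b c d. Qed.
Lemma quat2E (a b c d : R) : quat a b c d 0 (inord 2) = c.
Proof. by have [] := coord_quat a b c d. Qed.
Lemma quat3E (a b c d : R) : quat a b c d 0 (inord 3) = d.
Proof. by have [] := coord_quat a b c d. Qed.

Definition quatE := (quat0E, quat1E, quat2E, quat3E).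

Lemma quat_ext p q :
  p 0 (inord 0) = q 0 (inord 0) -> p 0 (inord 1) = q 0 (inord 1) ->
  p 0 (inord 2) = q 0 (inord 2) -> p 0 (inord 3) = q 0 (inord 3) -> p = q.
Proof.
move=> h0 h1 h2 h3; apply/rowP => i; rewrite -[i]inord_val.
by case: i => [[|[|[|[|]]]]].
Qed.

Lemma dotE p q : dot p q =
  p 0 (inord 0) * q 0 (inord 0) + p 0 (inord 1) * q 0 (inord 1) +
  p 0 (inord 2) * q 0 (inord 2) + p 0 (inord 3) * q 0 (inord 3).
Proof.
rewrite /dot 4!big_ord_recl big_ord0 addr0 !addrA.
by congr (_ * _ + _ * _ + _ * _ + _ * _); congr (_ 0 _);
  apply: val_inj; rewrite /= inordK.
Qed.

Lemma qmulA : associative (@qmul R).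
Proof. by move=> p q r; apply: quat_ext; rewrite !quatE; ring. Qed.

Lemma qmul1l : left_id qone (@qmul R).
Proof. by move=> p; apply: quat_ext; rewrite !quatE; ring. Qed.

Lemma qmul1r : right_id qone (@qmul R).
Proof. by move=> p; apply: quat_ext; rewrite !quatE; ring. Qed.

Lemma qmulDl : left_distributive (@qmul R) +%R.
Proof. by move=> p q r; apply: quat_ext; rewrite !(mxE, quatE) !inordK //=; ring. Qed.

Lemma qmulDr : right_distributive (@qmul R) +%R.
Proof. by move=> p q r; apply: quat_ext; rewrite !(mxE, quatE) !inordK //=; ring. Qed.

Lemma qone_neq0 : (qone : 'rV[R]_4) != 0.
Proof.
apply/eqP => /(congr1 (fun p : 'rV[R]_4 => p 0 (inord 0))).
by rewrite quatE mxE => /eqP; rewrite oner_eq0.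
Qed.

HB.instance Definition _ := GRing.Lmodule.on (quaternion R).
HB.instance Definition _ := GRing.Zmodule_isNzRing.Build (quaternion R)
  qmulA qmul1l qmul1r qmulDl qmulDr qone_neq0.

Lemma dotC p q : dot p q = dot q p.
Proof. by rewrite !dotE; ring. Qed.

Lemma dotDl p q r : dot (p + q) r = dot p r + dot q r.
Proof. by rewrite !dotE !mxE; ring. Qed.

Lemma dotDr p q r : dot r (p + q) = dot r p + dot r q.
Proof. by rewrite !dotE !mxE; ring. Qed.

Lemma dotZl k p q : dot (k *: p) q = k * dot p q.
Proof. by rewrite !dotE !mxE; ring. Qed.

Lemma dotZr k p q : dot p (k *: q) = k * dot p q.
Proof. by rewrite !dotE !mxE; ring. Qed.

Lemma dotNl p q : dot (- p) q = - dot p q.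
Proof. by rewrite !dotE !mxE; ring. Qed.

Lemma dotNr p q : dot p (- q) = - dot p q.
Proof. by rewrite !dotE !mxE; ring. Qed.

Lemma dot0l p : dot 0 p = 0.
Proof. by rewrite -(scale0r p) dotZl mul0r. Qed.

Lemma dot0r p : dot p 0 = 0.
Proof. by rewrite dotC dot0l. Qed.

Lemma dot_ge0 p : 0 <= dot p p.
Proof. by apply: sumr_ge0 => i _; rewrite -expr2 sqr_ge0. Qed.

Lemma dot_eq0 p : (dot p p == 0) = (p == 0).
Proof.
apply/idP/eqP => [|->]; last by rewrite dot0l.
rewrite psumr_eq0 => [/allP h|i _]; last by rewrite -expr2 sqr_ge0.
apply/rowP => i; rewrite mxE; apply/eqP.
by have := h i (mem_index_enum _); rewrite /= -expr2 sqrf_eq0.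
Qed.

Lemma dot_gt0 p : (0 < dot p p) = (p != 0).
Proof. by rewrite lt0r dot_ge0 andbT dot_eq0. Qed.

Lemma dot_conj p q : dot (qconj p) (qconj q) = dot p q.
Proof. by rewrite !dotE !quatE; ring. Qed.

Lemma dot_mull p q r : dot (p *q q) (p *q r) = dot p p * dot q r.
Proof. by rewrite !dotE !quatE; ring. Qed.

Lemma dot_mulr p q r : dot (q *q p) (r *q p) = dot p p * dot q r.
Proof. by rewrite !dotE !quatE; ring. Qed.

Lemma qmulZl k p q : (k *: p) *q q = k *: (p *q q).
Proof. by apply: quat_ext; rewrite !(mxE, quatE) !inordK //=; ring. Qed.

Lemma qmulZr k p q : p *q (k *: q) = k *: (p *q q).
Proof. by apply: quat_ext; rewrite !(mxE, quatE) !inordK //=; ring. Qed.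

Lemma qmul_conj p : p *q qconj p = dot p p *: qone.
Proof. by apply: quat_ext; rewrite dotE !(mxE, quatE) !inordK //=; ring. Qed.

Lemma qconj_mul p : qconj p *q p = dot p p *: qone.
Proof. by apply: quat_ext; rewrite dotE !(mxE, quatE) !inordK //=; ring. Qed.

Lemma qconjK p : qconj (qconj p) = p.
Proof. by apply: quat_ext; rewrite !quatE ?opprK. Qed.

Lemma qconjM p q : qconj (p *q q) = qconj q *q qconj p.
Proof. by apply: quat_ext; rewrite !quatE; ring. Qed.

Lemma qconjB p q : qconj (p - q) = qconj p - qconj q.
Proof. by apply: quat_ext; rewrite !(mxE, quatE) !inordK //=; ring. Qed.

Lemma qconjZ k p : qconj (k *: p) = k *: qconj p.
Proof. by apply: quat_ext; rewrite !(mxE, quatE) !inordK //=; ring. Qed.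

Lemma qconjV p : qconj (p^-1q) = (qconj p)^-1q.
Proof. by rewrite /qinv qconjZ dot_conj. Qed.

Let nonzero := [pred p : quaternion R | p != 0].
Let inv : quaternion R -> quaternion R := @qinv R.

Lemma qmulVl : {in nonzero, left_inverse 1 inv *%R}.
Proof.
move=> p; rewrite inE -dot_eq0 => p0.
by rewrite [LHS]qmulZl qconj_mul scalerA mulVf // scale1r.
Qed.

Lemma qmulVr : {in nonzero, right_inverse 1 inv *%R}.
Proof.
move=> p; rewrite inE -dot_eq0 => p0.
by rewrite [LHS]qmulZr qmul_conj scalerA mulVf // scale1r.
Qed.

Lemma qunitP (p q : quaternion R) : q * p = 1 /\ p * q = 1 -> p \in nonzero.
Proof.
move=> [h _]; rewrite inE; apply: contra_eq_neq h => ->.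
by rewrite mulr0 eq_sym oner_eq0.
Qed.

(** The ring structure wants the inverse to be the identity on non-units; here the only one is 0,
    which [qinv] fixes. Hence [^-1] and [qinv] agree everywhere. *)
Lemma qinv_out : {in [predC nonzero], inv =1 id}.
Proof.
by move=> p; rewrite !inE negbK => /eqP ->; rewrite /inv /qinv dot0l invr0 scale0r.
Qed.

HB.instance Definition _ := GRing.NzRing_hasMulInverse.Build (quaternion R)
  qmulVl qmulVr qunitP qinv_out.

End Coordinates.

(** * Norms and cosines of quaternions *)

Section Norm.
Variable R : realType.
Implicit Types (k l : R) (p q r x y z : quaternion R).

Lemma qunitE p : (p \is a GRing.unit) = (p != 0).
Proof. by []. Qed.

Lemma qmulE p q : p *q q = p * q. Proof. by []. Qed.
Lemma qinvE p : p^-1q = p^-1. Proof. by []. Qed.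

Lemma qconjD p q : qconj (p + q) = qconj p + qconj q.
Proof. by apply: quat_ext; rewrite !(mxE, quatE) !inordK //=; ring. Qed.

Lemma qconjN p : qconj (- p) = - qconj p :> quaternion R.
Proof. by apply: quat_ext; rewrite !(mxE, quatE) !inordK. Qed.

Lemma qconj0 : qconj 0 = 0 :> quaternion R.
Proof. by rewrite -[in LHS](subrr (0 : 'rV[R]_4)) qconjB subrr. Qed.

Lemma qconj_opp1 : qconj (- qone) = - qone :> quaternion R.
Proof. by apply: quat_ext; rewrite !(mxE, quatE) !inordK //=; ring. Qed.

(** Up to conjugation, the inverse of a quaternion is the inversion in the unit sphere; this is the
    link between the algebra and the circles. *)
Lemma conjV p : qconj p^-1 = (dot p p)^-1 *: p :> quaternion R.
Proof. by rewrite -[p^-1]/(qinv p) /qinv qconjZ qconjK. Qed.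

Lemma scaleqAl k p q : k *: (p * q) = (k *: p) * q.
Proof. by rewrite -[RHS]qmulE qmulZl. Qed.

Lemma scaleqAr k p q : k *: (p * q) = p * (k *: q).
Proof. by rewrite -[RHS]qmulE qmulZr. Qed.

Lemma dotMl p x y : dot (p * x) (p * y) = dot p p * dot x y.
Proof. exact: dot_mull. Qed.

Lemma dotMr p x y : dot (x * p) (y * p) = dot p p * dot x y.
Proof. exact: dot_mulr. Qed.

Lemma dot_mul x y : dot (x * y) (x * y) = dot x x * dot y y.
Proof. exact: dotMl. Qed.

Lemma dot1 : dot (1 : quaternion R) (1 : quaternion R) = 1.
Proof. by rewrite dotE !quatE; ring. Qed.

Lemma dotV x : dot x^-1 x^-1 = (dot x x)^-1.
Proof.
have [->|x0] := eqVneq x 0; first by rewrite invr0 dot0l invr0.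
have u : dot x x != 0 by rewrite dot_eq0.
by apply: (mulfI u); rewrite mulfV // -dot_mul mulrV // dot1.
Qed.

Lemma dot_opp x y : dot (- x) (- y) = dot x y.
Proof. by rewrite dotNl dotNr opprK. Qed.

Lemma mulq_neq0 x y : x != 0 -> y != 0 -> x * y != 0.
Proof. by move=> x0 y0; rewrite -dot_eq0 dot_mul mulf_neq0 // dot_eq0. Qed.

Lemma invq_eq0 x : (x^-1 == 0) = (x == 0).
Proof. by rewrite -!dot_eq0 dotV invr_eq0. Qed.

Lemma invqB x y : x != 0 -> y != 0 -> x^-1 - y^-1 = x^-1 * (y - x) * y^-1.
Proof.
move=> x0 y0; rewrite mulrBr mulrBl -mulrA.
by rewrite mulrV // mulVr // mulr1 mul1r.
Qed.

Lemma invqD x y : x != 0 -> y != 0 -> x^-1 + y^-1 = x^-1 * (y + x) * y^-1.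
Proof.
move=> x0 y0; rewrite mulrDr mulrDl -mulrA.
by rewrite mulrV // mulVr // mulr1 mul1r.
Qed.

Lemma invqM3 x y z : x != 0 -> y != 0 -> z != 0 ->
  (x * y * z)^-1 = z^-1 * y^-1 * x^-1.
Proof.
move=> x0 y0 z0; have xy0 := mulq_neq0 x0 y0.
by rewrite (@invrM _ _ z xy0 z0) (@invrM _ x y x0 y0) mulrA.
Qed.

Lemma enorm_sqr p : enorm p ^+ 2 = dot p p.
Proof. by rewrite sqr_sqrtr // dot_ge0. Qed.

Lemma enorm_ge0 p : 0 <= enorm p.
Proof. exact: sqrtr_ge0. Qed.

Lemma enorm_eq0 p : (enorm p == 0) = (p == 0).
Proof. by rewrite -dot_eq0 -enorm_sqr sqrf_eq0. Qed.

Lemma enorm_gt0 p : (0 < enorm p) = (p != 0).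
Proof. by rewrite lt0r enorm_eq0 enorm_ge0 andbT. Qed.

Lemma enormM p q : enorm (p * q) = enorm p * enorm q.
Proof. by rewrite /enorm dot_mul sqrtrM // dot_ge0. Qed.

Lemma enormV p : enorm p^-1 = (enorm p)^-1.
Proof. by rewrite /enorm dotV sqrtrV // dot_ge0. Qed.

Lemma enormN p : enorm (- p) = enorm p.
Proof. by rewrite /enorm dot_opp. Qed.

Lemma enormB p q : enorm (p - q) = enorm (q - p).
Proof. by rewrite -opprB enormN. Qed.

Lemma enormZ k p : enorm (k *: p) = `|k| * enorm p.
Proof. by rewrite /enorm dotZl dotZr mulrA -expr2 sqrtrM ?sqr_ge0 // sqrtr_sqr. Qed.

Definition cosine p q : R := dot p q / (enorm p * enorm q).

Lemma cosineZ k l p q : 0 < k -> 0 < l -> cosine (k *: p) (l *: q) = cosine p q.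
Proof.
move=> k0 l0; rewrite /cosine !enormZ dotZl dotZr !gtr0_norm //.
have [->|p0] := eqVneq p 0; first by rewrite dot0l !mulr0 !mul0r.
have [->|q0] := eqVneq q 0; first by rewrite dot0r !mulr0 !mul0r.
have /lt0r_neq0 := k0; have /lt0r_neq0 := l0.
move: p0 q0; rewrite -!enorm_eq0 => *; field.
by apply/and4P; split.
Qed.

Lemma cosineN p q : cosine (- p) (- q) = cosine p q.
Proof. by rewrite /cosine !enormN dot_opp. Qed.

Lemma cosine_conj p q : cosine (qconj p) (qconj q) = cosine p q.
Proof. by rewrite /cosine /enorm !dot_conj. Qed.

(** Left and right multiplications by nonzero quaternions are similarities. *)
Lemma cosineM a b p q : a != 0 -> b != 0 ->
  cosine (a * p * b) (a * q * b) = cosine p q.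
Proof.
move=> a0 b0; rewrite /cosine !enormM dotMr dotMl -!enorm_sqr.
have [->|p0] := eqVneq p 0; first by rewrite dot0l !mulr0 !mul0r.
have [->|q0] := eqVneq q 0; first by rewrite dot0r !mulr0 !mul0r.
move: a0 b0 p0 q0; rewrite -!enorm_eq0 => *; field.
by apply/and4P; split.
Qed.

Lemma cauchy_schwarz p q : `|dot p q| <= enorm p * enorm q.
Proof.
rewrite -(@ler_pXn2r _ 2) ?nnegrE ?mulr_ge0 ?enorm_ge0 //.
rewrite real_normK ?num_real // exprMn !enorm_sqr.
have [->|q0] := eqVneq q 0; first by rewrite !dot0r expr0n mulr0.
have := dot_ge0 (dot q q *: p - dot p q *: q).
rewrite dotDl !dotDr !dotNl !dotNr !dotZl !dotZr (dotC q p).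
have : 0 < dot q q by rewrite dot_gt0.
move: (dot p p) (dot p q) (dot q q) => u v w w0 h.
have {h} : 0 <= w * (u * w - v ^+ 2) by apply: le_trans h _; lra.
by rewrite pmulr_rge0 // subr_ge0.
Qed.

Lemma cosine_bound p q : -1 <= cosine p q <= 1.
Proof.
rewrite -ler_norml /cosine.
have [->|p0] := eqVneq p 0; first by rewrite dot0l mul0r normr0.
have [->|q0] := eqVneq q 0; first by rewrite dot0r mul0r normr0.
have e : 0 < enorm p * enorm q by rewrite mulr_gt0 // enorm_gt0.
by rewrite normrM normfV (gtr0_norm e) ler_pdivrMr // mul1r cauchy_schwarz.
Qed.

Lemma acos_cosine_inj p q x y : acos (cosine p q) = acos (cosine x y) ->
  cosine p q = cosine x y.
Proof.
move=> h; rewrite -(@acosK _ (cosine p q)) ?h ?acosK //.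
all: by rewrite in_itv /= cosine_bound.
Qed.

End Norm.

(** * Inversion and the multi-ratio *)

Section Direction.
Variable R : realType.
Implicit Types (x y z t X Y Z a b : quaternion R).

(* The conjugate of [direction x y z] is a positive multiple of the tangent at
   [x] of the circle which passes through [x], [y], [z] in this order. *)
Definition direction x y z : quaternion R := (y - x)^-1 - (z - x)^-1.

Lemma directionE x y z : x != y -> x != z ->
  direction x y z = (y - x)^-1 * (z - y) * (z - x)^-1.
Proof.
move=> xy xz; rewrite /direction invqB ?subr_eq0 1?eq_sym //.
by rewrite opprB addrA subrK.
Qed.

Lemma direction_neq0 x y z : x != y -> x != z -> y != z -> direction x y z != 0.
Proof.
move=> xy xz yz; rewrite directionE //.
by rewrite !mulq_neq0 ?invq_eq0 ?subr_eq0 1?eq_sym // eq_sym.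
Qed.

Lemma directionC x y z : direction x z y = - direction x y z.
Proof. by rewrite /direction opprB. Qed.

Lemma direction_translate t x y z :
  direction (x - t) (y - t) (z - t) = direction x y z.
Proof. by rewrite /direction !opprB !addrA !subrK. Qed.

Lemma direction_conj x y z :
  direction (qconj x) (qconj y) (qconj z) = qconj (direction x y z).
Proof. by rewrite /direction -!qconjB -!qinvE -!qconjV -qconjB. Qed.

(** The term [- x] does not depend on [y], so it cancels in a [direction], which is a difference of
    two such inverses. *)
Lemma invqB_inv x y : x != 0 -> y != 0 -> x != y ->
  (y^-1 - x^-1)^-1 = x * (x - y)^-1 * x - x.
Proof.
move=> x0 y0 xy; have d : x - y != 0 by rewrite subr_eq0.
rewrite invqB // invqM3 ?invq_eq0 // !invrK.
by rewrite -{2}[y](subKr x) mulrBr mulrVK.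
Qed.

(** The same formula for the point 0, the image of infinity: the middle factor becomes 0. *)
Lemma sub0Vq x : (0 - x^-1)^-1 = x * 0 * x - x.
Proof. by rewrite mulr0 mul0r !sub0r invrN invrK. Qed.

(** [eY] and [eZ] are abstract so that one statement covers both finite points and the point at
    infinity. *)
Lemma direction_inv x Y Z eY eZ :
  (Y - x^-1)^-1 = x * eY * x - x -> (Z - x^-1)^-1 = x * eZ * x - x ->
  direction x^-1 Y Z = x * (eY - eZ) * x.
Proof.
by move=> hY hZ; rewrite /direction hY hZ opprB addrA subrK mulrBr mulrBl.
Qed.

End Direction.

(* From here on Phi_13 is at 0, and [a], [b], [a'], [b'], [c] are the inverses of
   Phi_14, Phi_12, Phi_23, Phi_34, Phi_24, so that Phi_13 goes to infinity. *)
Section NormalForm.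
Variable R : realType.
Variables a b a' b' c : quaternion R.
Let s0 : quaternion R := b - a.
Let s1 : quaternion R := a' - b.
Let s2 : quaternion R := a - b'.
Let s3 : quaternion R := b' - a'.
Let S : quaternion R := s0 + s3.

(** One chord from [c] determines the other three, because the quadrilateral closes: s1 = - S - s2
    and s3 = S - s0. *)
Lemma chords : S != 0 -> c - a = - (s2 * S^-1 * s0) ->
  [/\ c - b = s1 * S^-1 * s0, c - a' = - (s1 * S^-1 * s3) &
      c - b' = s2 * S^-1 * s3].
Proof.
move=> S0 ca.
have e1 : s1 * S^-1 = - 1 - s2 * S^-1.
  have -> : s1 = - S - s2.
    by rewrite /S /s0 /s1 /s2 /s3; apply/rowP => i; rewrite !mxE; ring.
  by rewrite mulrBl mulNr mulrV.
have e3 : s3 = S - s0 by rewrite /S addrC addKr.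
have cb : c - b = s1 * S^-1 * s0.
  rewrite e1 mulrBl mulNr mul1r -ca.
  by rewrite /s0; apply/rowP => i; rewrite !mxE; ring.
split=> //; rewrite [in RHS]e3 mulrBr mulrVK // -?cb.
  by rewrite /s1; apply/rowP => i; rewrite !mxE; ring.
by rewrite -[s2 * _ * _]opprK -ca /s2; apply/rowP => i; rewrite !mxE; ring.
Qed.

Hypotheses (a0 : a != 0) (b0 : b != 0) (a'0 : a' != 0) (b'0 : b' != 0)
  (c0 : c != 0).
Hypotheses (ab : a != b) (ba' : b != a') (a'b' : a' != b') (b'a : b' != a)
  (bc : b != c).

(** A difference of inverses factors as x^-1 (y - x) y^-1 or as y^-1 (y - x) x^-1. The first form is
    used for the plain factors and the second for the inverted ones, so that b, c, a', b' cancel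
    between neighbours. *)
Lemma multiratio_inv :
  multiratio a^-1 b^-1 c^-1 a'^-1 b'^-1 0 =
  a^-1 * (s0 * (c - b)^-1 * (a' - c) * s3^-1) * - a :> quaternion R.
Proof.
have cb0 : c - b != 0 by rewrite subr_eq0 eq_sym.
have s30 : s3 != 0 by rewrite subr_eq0 eq_sym.
have invqB' (x y : quaternion R) : x != 0 -> y != 0 ->
    x^-1 - y^-1 = y^-1 * (y - x) * x^-1.
  by move=> x0 y0; rewrite -opprB invqB // -[in RHS]opprB mulrN mulNr.
rewrite /multiratio !qmulE !qinvE subr0 sub0r (invqB a0 b0) (invqB' _ _ b0 c0).
rewrite (invqB c0 a'0) (invqB' _ _ a'0 b'0).
rewrite !invqM3 ?invq_eq0 // !invrN !invrK.
have [ub uc] : b \is a GRing.unit /\ c \is a GRing.unit := conj b0 c0.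
have [ua' ub'] : a' \is a GRing.unit /\ b' \is a GRing.unit := conj a'0 b'0.
rewrite !mulrA; congr (_ * - a).
by rewrite (mulrVK ub) (mulrVK ua') (mulrK ub') (mulrK uc).
Qed.

(** Conjugating by [a] leaves a' - c = (c - b) s0^-1 s3. Adding c - b gives s1 = (c - b) s0^-1 S, so
    S cannot vanish, since s1 does not. *)
Lemma normal_form :
  multiratio a^-1 b^-1 c^-1 a'^-1 b'^-1 0 = - 1 :> quaternion R ->
  [/\ S != 0, c - a = - (s2 * S^-1 * s0), c - b = s1 * S^-1 * s0,
      c - a' = - (s1 * S^-1 * s3) & c - b' = s2 * S^-1 * s3].
Proof.
rewrite multiratio_inv.
have s10 : s1 != 0 by rewrite subr_eq0 eq_sym.
have s00 : s0 != 0 by rewrite subr_eq0 eq_sym.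
have s30 : s3 != 0 by rewrite subr_eq0 eq_sym.
have cb0 : c - b != 0 by rewrite subr_eq0 eq_sym.
set X := _ * s3^-1 => h.
have X1 : X = 1.
  have : a * (a^-1 * X * - a) * a^-1 = a * - 1 * a^-1 by rewrite h.
  by rewrite !mulrN !mulNr mulr1 !mulrA !mulrK // mulrV // mul1r => /oppr_inj.
have e : a' - c = (c - b) * s0^-1 * s3.
  have : (c - b) * s0^-1 * X * s3 = (c - b) * s0^-1 * s3 by rewrite X1 mulr1.
  by rewrite /X !mulrA mulrVK // mulrVK // mulrV // mul1r.
have e1 : s1 = (c - b) * s0^-1 * S.
  rewrite /S mulrDr -e mulrVK //.
  by rewrite /S /s0 /s1 /s2 /s3; apply/rowP => i; rewrite !mxE; ring.
have S0 : S != 0 by apply: contra_neq s10 => h0; rewrite e1 h0 mulr0.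
have ecb : c - b = s1 * S^-1 * s0 by rewrite e1 mulrK // mulrVK.
have ca : c - a = - (s2 * S^-1 * s0).
  have -> : s2 = - S - s1.
    by rewrite /S /s0 /s1 /s2 /s3; apply/rowP => i; rewrite !mxE; ring.
  rewrite mulrBl mulNr mulrV // mulrBl mulNr mul1r -ecb.
  by rewrite /s0; apply/rowP => i; rewrite !mxE; ring.
by have [? ? ?] := chords S0 ca.
Qed.

Lemma multiratio_normal_form : S != 0 -> c - a = - (s2 * S^-1 * s0) ->
  multiratio a^-1 b^-1 c^-1 a'^-1 b'^-1 0 = - 1 :> quaternion R.
Proof.
move=> S0 ca.
have s10 : s1 != 0 by rewrite subr_eq0 eq_sym.
have s00 : s0 != 0 by rewrite subr_eq0 eq_sym.
have s30 : s3 != 0 by rewrite subr_eq0 eq_sym.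
have [cb ca' _] := chords S0 ca.
have a'c : a' - c = s1 * S^-1 * s3 by rewrite -opprB ca' opprK.
rewrite multiratio_inv cb a'c invqM3 ?invq_eq0 // invrK.
by rewrite !mulrA !mulrK // mulrVK // !mulrK // mulrN mulVr.
Qed.

End NormalForm.

Section Links.
Variable R : realType.
Implicit Types u v S : quaternion R.

(** For the sides [u], [v] meeting at one of a, b, a', b', the other two sides are S - u and - S -
    v, and u^-1 S v^-1 is, up to sign, the inverse of the chord from that vertex to [c]. *)
Lemma side_combinations u v S : u != 0 -> v != 0 ->
  [/\ u^-1 * u * v^-1 = v^-1, u^-1 * v * v^-1 = u^-1,
      u^-1 * (S - u) * v^-1 = u^-1 * S * v^-1 - v^-1 &
      u^-1 * (- S - v) * v^-1 = - u^-1 - u^-1 * S * v^-1].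
Proof.
move=> u0 v0; rewrite !mulrBr !mulrBl mulrK // mulVr // mul1r mulrN mulNr.
by split => //; rewrite addrC.
Qed.

End Links.

(** * The octahedron *)

(* The four neighbours of a vertex in the cyclic order in which they are seen
   from outside. *)
Definition link (v : vertex) : seq vertex :=
  match v with
  | V14 => [:: V12; V24; V34; V13]
  | V12 => [:: V24; V14; V13; V23]
  | V24 => [:: V14; V12; V23; V34]
  | V23 => [:: V12; V13; V34; V24]
  | V34 => [:: V13; V14; V24; V23]
  | V13 => [:: V12; V14; V34; V23]
  end.

(** The eight faces with their outside orientation; the relation is invariant under cyclic rotation
    of [v], [w], [x]. *)
Definition positive (v w x : vertex) : bool :=
  (w \in link v) && (x == next (link v) w).

(* Classes of corresponding circles: encode a face by the parities telling on
   which side of each of the three axes it lies, add the unit vector of the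
   axis of the vertex, and reduce modulo the antipodal map (1,1,1). *)
Definition class_code (i j k : bool) (v : vertex) : bool * bool :=
  let i := if v is (V14 | V23) then ~~ i else i in
  let j := if v is (V12 | V34) then ~~ j else j in
  let k := if v is (V24 | V13) then ~~ k else k in
  (i (+) k, j (+) k).

Definition class_of (f : {set vertex}) (v : vertex) : bool * bool :=
  class_code (V14 \in f) (V12 \in f) (V24 \in f) v.

Lemma card_vertex_set (f : {set vertex}) :
  #|f| = ((V12 \in f) + (V13 \in f) + (V14 \in f) +
          (V23 \in f) + (V24 \in f) + (V34 \in f))%N.
Proof.
have E : perm_eq (index_enum vertex) [:: V12; V13; V14; V23; V24; V34].
  by apply: uniq_perm => [|//|[]]; rewrite ?index_enum_uniq ?mem_index_enum.
rewrite -sum1_card big_mkcond /= (perm_big _ E) /= !big_cons big_nil /= addn0 !addnA.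
by do 6!case: (_ \in f).
Qed.

(** Three vertices, at most one on each of the three axes, hence exactly one on each. *)
Lemma faceP (f : face) v : (opposite v \in val f) = (v \notin val f).
Proof.
case: f => f /= /andP[/eqP f3 /forall_inP h].
have {}h w : w \in f -> opposite w \notin f by move=> /h.
have := h V12; have := h V13; have := h V14.
have := f3; rewrite card_vertex_set.
case: v; do 6!case: (_ \in f) => //=; move=> e h1 h2 h3;
  by [have := h1 isT | have := h2 isT | have := h3 isT].
Qed.

Lemma mem_face (f : face) v : (v \in val f) =
  match v with
  | V14 => V14 \in val f | V12 => V12 \in val f | V24 => V24 \in val f
  | V23 => V14 \notin val f | V34 => V12 \notin val f | V13 => V24 \notin val f
  end.
Proof. by case: v; rewrite -?faceP. Qed.

Lemma face_ext (f g : face) :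
  (V14 \in val f) = (V14 \in val g) -> (V12 \in val f) = (V12 \in val g) ->
  (V24 \in val f) = (V24 \in val g) -> f = g.
Proof.
move=> h1 h2 h3; apply/val_inj/setP => v; rewrite !mem_face.
by case: v; rewrite ?h1 ?h2 ?h3.
Qed.

(** Across an edge the faces differ on the third axis and the vertices lie on the other two, so the
    code changes by (1,1,1) in all. For opposite circles the face code changes by (1,1,1) and the
    axis stays. *)
Lemma class_of_corr x y : corr x y ->
  [/\ x.2 \in val x.1, y.2 \in val y.1 &
      class_of (val x.1) x.2 = class_of (val y.1) y.2].
Proof.
elim=> {x y} [f g v w fg vw vf vg wf wg|f g v vf h|f v vf|x y _ [? ? ->]|
  x y z _ [? ? ->] _ [? ? ->]] //=; split=> //=.
- have : ~~ [&& (V14 \in val f) == (V14 \in val g),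
     (V12 \in val f) == (V12 \in val g) & (V24 \in val f) == (V24 \in val g)].
    by apply: contra fg => /and3P[/eqP h1 /eqP h2 /eqP h3]; apply/eqP/face_ext.
  move: vw vf vg wf wg; rewrite !(mem_face _ v) !(mem_face _ w) /class_of.
  by case: v; case: w => //=; do 6!case: (_ \in _).
- by rewrite faceP h.
have c w : (w \in val g) = (w \notin val f).
  apply/idP/idP => [|wf]; first by apply: contraL => /h.
  by rewrite -[w \in _]negbK -faceP h // faceP.
by rewrite /class_of !c; case: v {vf} => /=; do 3!case: (_ \in _).
Qed.

Lemma positive_face (f : face) v w x : positive v w x ->
  w \in val f -> x \in val f -> v \in val f -> val f = [set v; w; x]%SET.
Proof.
move=> p wf xf vf; apply/setP => y.
move: p wf xf vf.
rewrite !inE !(mem_face f v) !(mem_face f w) !(mem_face f x) (mem_face f y).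
by case: v; case: w => //; case: x => //; case: y => //=; do 3!case: (_ \in _).
Qed.

Lemma exists_positive (f : face) v : v \in val f ->
  exists w x, val f = [set v; w; x]%SET /\ positive v w x.
Proof.
move=> vf.
pose good w x := [&& positive v w x, w \in val f & x \in val f].
have : has (fun w => has (good w) (link v)) (link v).
  move: vf; rewrite /good !(mem_face f v).
  have /= m23 := mem_face f V23; have /= m34 := mem_face f V34.
  have /= m13 := mem_face f V13.
  by case: v {good} => /=; rewrite ?m23 ?m34 ?m13; do 3!case: (_ \in _).
move=> /hasP[w _ /hasP[x _ /and3P[p wf xf]]].
by exists w, x; split=> //; apply: positive_face.
Qed.

Lemma face_triple (f : face) v w x : val f = [set v; w; x]%SET ->
  positive v w x || positive v x w.
Proof.
move=> e; have := faceP f V12; have := faceP f V13; have := faceP f V14.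
by rewrite e !inE; case: v {e}; case: w => //; case: x.
Qed.

(** The combinatorial counterpart of [coherent], to which the coherence of a chosen orientation
    reduces. *)
Lemma positive_adjacent (f g : face) v w a b : f != g ->
  val f = [set v; w; a]%SET -> val g = [set v; w; b]%SET ->
  positive v w a -> positive w v b.
Proof.
move=> fg ef eg.
have ab : a != b by apply: contra fg => /eqP h; apply/eqP/val_inj; rewrite ef eg h.
have := faceP g V12; have := faceP g V13; have := faceP g V14.
rewrite eg !inE; move: ab {ef eg}.
by case: v; case: w => //; case: a => //; case: b.
Qed.

Lemma face_of_subproof (i j k : bool) :
  is_face [set if i then V14 else V23; if j then V12 else V34;
               if k then V24 else V13].
Proof.
apply/andP; split; first by rewrite card_vertex_set !inE; case: i; case: j; case: k.
by apply/forall_inP => v; rewrite !inE; case: v; case: i; case: j; case: k.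
Qed.

Definition face_of i j k : face :=
  exist (fun f => is_true (is_face f)) _ (face_of_subproof i j k).

Lemma face_of_neq i j k i' j' k' :
  [|| i != i', j != j' | k != k'] -> face_of i j k != face_of i' j' k'.
Proof.
apply: contraL => /eqP/(congr1 val)/= e.
have h v := congr1 (fun s : {set vertex} => v \in s) e.
have := h V14; have := h V12; have := h V24.
by rewrite !inE; case: i {e h}; case: j; case: k; case: i'; case: j'; case: k'.
Qed.

Lemma face_ofE (f : face) :
  f = face_of (V14 \in val f) (V12 \in val f) (V24 \in val f).
Proof. by apply: face_ext; rewrite !inE; do 3!case: ifP. Qed.

(** Any face is reached from a given one by crossing edges, so a coherent orientation is fixed by
    its value on one face. *)
Lemma orientation_propagates (T : face -> vertex -> vertex -> vertex -> Prop) :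
  (forall f v w x, T f v w x -> T f w x v) ->
  (forall f g v w a b, f != g -> val f = [set v; w; a]%SET ->
     val g = [set v; w; b]%SET -> T f v w a -> T g w v b) ->
  T (face_of true true true) V14 V12 V24 ->
  forall f v w x, positive v w x -> val f = [set v; w; x]%SET -> T f v w x.
Proof.
move=> cyc coh T0.
pose X i := if i then V14 else V23; pose Y j := if j then V12 else V34.
pose Z k := if k then V24 else V13.
(* Changing one coordinate crosses an edge and reverses the positive order of the three vertices;
   the parity keeps track of it. *)
pose T' i j k := if i (+) j (+) k then T (face_of i j k) (X i) (Y j) (Z k)
  else T (face_of i j k) (X i) (Z k) (Y j).
have e i j k : val (face_of i j k) = [set X i; Y j; Z k]%SET by [].
have perm3 (a b c : vertex) : ([set a; b; c] = [set b; c; a])%SET.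
  by rewrite [RHS]finset.setUC finset.setUA.
have swap3 (a b c : vertex) : ([set a; b; c] = [set b; a; c])%SET.
  by rewrite (finset.setUC [set a]%SET).
have flip1 i j k : T' i j k -> T' (~~ i) j k.
  have n : face_of i j k != face_of (~~ i) j k.
    by rewrite face_of_neq //; case: i.
  rewrite /T' !addNb; case: (i (+) j (+) k) => /= /cyc h; apply/cyc/cyc.
    by apply: coh h; rewrite ?e.
  by apply: coh h; rewrite // e swap3 perm3.
have flip2 i j k : T' i j k -> T' i (~~ j) k.
  have n : face_of i j k != face_of i (~~ j) k.
    by rewrite face_of_neq //; case: j; rewrite ?orbT.
  rewrite /T' !(addbN, addNb); case: (i (+) j (+) k) => /= h.
    by move/cyc/cyc in h; apply: coh h; rewrite // e -perm3.
  by apply/cyc; apply: coh h; rewrite // e perm3 swap3.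
have flip3 i j k : T' i j k -> T' i j (~~ k).
  have n : face_of i j k != face_of i j (~~ k).
    by rewrite face_of_neq //; case: k; rewrite ?orbT.
  rewrite /T' !(addbN, addNb); case: (i (+) j (+) k) => /= h.
    by apply/cyc; apply: coh h.
  by move/cyc/cyc in h; apply: coh h; rewrite // e swap3.
have all i j k : T' i j k.
  have h : T' true true k by case: k => //; apply: (flip3 true true true).
  have {}h : T' true j k by case: j => //; apply: (flip2 true true k).
  by case: i => //; apply: (flip1 true j k).
move=> f v w x p ef; move: p (ef); rewrite (face_ofE f) ef !inE.
have := all (V14 \in val f) (V12 \in val f) (V24 \in val f).
rewrite ef !inE /T' /X /Y /Z.
by case: v {ef}; case: w => //; case: x => //= /cyc h _ _;
  first [exact: h | exact: (cyc _ _ _ _ h)].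
Qed.

(** * Circles *)

Section Circles.
Variable R : realType.

Lemma exists_angle (p q : R) : p ^+ 2 + q ^+ 2 = 1 ->
  exists t, [/\ - pi <= t, t <= pi, cos t = p & sin t = q].
Proof.
move=> pq.
have q2 : q ^+ 2 = 1 - p ^+ 2 by rewrite -pq addrC addKr.
have p1 : -1 <= p <= 1.
  by rewrite -ler_norml -(@expr_le1 _ 2) // real_normK ?num_real // -subr_ge0 -q2 sqr_ge0.
have [q0|q0] := leP 0 q.
  exists (acos p); rewrite acosK ?in_itv //= acos_lepi // sin_acos // -q2.
  rewrite sqrtr_sqr ger0_norm //; split=> //.
  by rewrite (le_trans _ (acos_ge0 p1)) // oppr_le0 pi_ge0.
exists (- acos p); rewrite cosN sinN acosK ?in_itv //= sin_acos // -q2.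
rewrite sqrtr_sqr ltr0_norm // opprK lerN2 acos_lepi //; split=> //.
by rewrite (le_trans _ (pi_ge0 _)) // oppr_le0 acos_ge0.
Qed.

(** A full turn added to a negative [d] brings the parameter into the window that [passes]
    prescribes. *)
Lemma angle_window (s d : R) : - pi <= d -> d <= pi -> d != 0 ->
  exists t, [/\ s < t, t < s + pi *+ 2, cos t = cos (s + d) & sin t = sin (s + d)].
Proof.
have pi0 := @pi_gt0 R; move=> d1 d2.
have [d0 _|d0 _|->] := ltrgtP d 0; last by [].
  by exists (s + d + pi *+ 2); rewrite cosD2pi sinD2pi; split=> //; lra.
by exists (s + d); split=> //; lra.
Qed.

Lemma derive1_circle (c u v : 'rV[R]_4) (r s : R) :
  derive1 (fun s => c + (r * cos s) *: u + (r * sin s) *: v) s =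
  r *: (- sin s *: u + cos s *: v).
Proof.
have D i j : is_derive s 1
    (fun s => (c + (r * cos s) *: u + (r * sin s) *: v) i j)
    ((r *: (- sin s *: u + cos s *: v)) i j).
  rewrite (_ : (fun s => _) =
    (fun s => c i j + r * cos s * u i j + r * sin s * v i j)); last first.
    by apply/funext => s'; rewrite !mxE.
  rewrite !mxE.
  apply: is_derive_eq.
  by rewrite !scaler0 /GRing.scale /=; ring.
rewrite derive1E derive_mx; last by apply/derivable_mxP => i j; have [] := D i j.
by apply/matrixP => i j; rewrite mxE; have [_ ->] := D i j.
Qed.

Lemma derive1_line (a d : 'rV[R]_4) (s : R) :
  derive1 (fun s => a + s *: d) s = d.
Proof.
have D i j : is_derive s 1 (fun s => (a + s *: d) i j) (d i j).
  rewrite (_ : (fun s => _) = (fun s => a i j + s * d i j)); last first.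
    by apply/funext => s'; rewrite !mxE.
  apply: is_derive_eq.
  by rewrite !scaler0 /GRing.scale /=; ring.
rewrite derive1E derive_mx; last by apply/derivable_mxP => i j; have [] := D i j.
by apply/matrixP => i j; rewrite mxE; have [_ ->] := D i j.
Qed.

Section Circle.
Variables (c u v : 'rV[R]_4) (r : R).
Hypotheses (r0 : 0 < r) (uu : dot u u = 1) (vv : dot v v = 1) (uv : dot u v = 0).
Let C := OCircle c r0 uu vv uv.

(** The outward unit normal in the plane of the circle and, next, the unit tangent. *)
Definition radial s : 'rV[R]_4 := cos s *: u + sin s *: v.
Definition forward s : 'rV[R]_4 := - sin s *: u + cos s *: v.

Lemma param_circle s : param C s = c + r *: radial s.
Proof. by rewrite /= scalerDr !scalerA addrA. Qed.

Lemma radial_forward s : [/\ dot (radial s) (radial s) = 1,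
  dot (forward s) (forward s) = 1 & dot (forward s) (radial s) = 0].
Proof.
rewrite /radial /forward !dotDl !dotDr !dotZl !dotZr (dotC v u) uu vv uv.
have := cos2Dsin2 s; move: (cos s) (sin s) => x y e.
by split; rewrite !mulr1 -?e; ring.
Qed.

Lemma radialD s t : radial (s + t) = cos t *: radial s + sin t *: forward s.
Proof.
by rewrite /radial /forward cosD sinD; apply/rowP => i; rewrite !mxE; ring.
Qed.

(** Makes the velocity at a point independent of the parameter value picked by [xget]. *)
Lemma radial_inj s t : radial s = radial t -> forward s = forward t.
Proof.
move=> h; have := congr1 (dot u) h; have := congr1 (dot v) h.
rewrite /radial /forward !dotDr !dotZr (dotC v u) uu vv uv.
by rewrite !mulr0 !mulr1 !addr0 !add0r => -> ->.
Qed.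

Lemma param_eq s t : param C s = param C t -> radial s = radial t.
Proof.
rewrite !param_circle => /addrI.
by apply: scalerI; rewrite lt0r_neq0.
Qed.

Lemma tangent_circle s : tangent C (param C s) = r *: forward s.
Proof.
rewrite /tangent; case: xgetP => [t _ [s' /= e <-]|]; last first.
  by move=> /(_ (r *: forward s))[]; exists s => //=; rewrite derive1_circle.
by rewrite derive1_circle -/(forward s') (radial_inj (@param_eq s' s e)).
Qed.

Lemma exists_param_circle s p q : p ^+ 2 + q ^+ 2 = 1 ->
  exists t, c + r *: (p *: radial s + q *: forward s) = param C (s + t).
Proof.
move=> /exists_angle[t [_ _ <- <-]]; exists t.
by rewrite param_circle radialD.
Qed.

Lemma param_after s t : param C s != param C t ->
  exists t', [/\ s < t', t' < s + pi *+ 2 & param C t' = param C t].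
Proof.
move=> st.
have [d [d1 d2 dc ds]] := exists_angle (cos2Dsin2 (t - s)).
have e : param C (s + d) = param C t.
  by rewrite !param_circle radialD dc ds -radialD [s + _]addrC subrK.
have d0 : d != 0 by apply: contra_neq st => d0; rewrite -e d0 addr0.
have [t' [t1 t2 tc ts]] := angle_window s d1 d2 d0.
by exists t'; rewrite -e /= tc ts.
Qed.

(** Inversion at a point of the circle maps the circle to a line parallel to the tangent there. With
    the parameter difference written as 2 t, the position on that line is the cotangent of the
    inscribed angle t. *)
Lemma inverted_chord s t (p := param C (s + t *+ 2) - param C s) : sin t != 0 ->
  (dot p p)^-1 *: p = (2 * r)^-1 *: ((cos t / sin t) *: forward s - radial s).
Proof.
move=> st.
have ep : p = (2 * r * sin t) *: (cos t *: forward s - sin t *: radial s).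
  rewrite /p !param_circle radialD mulr2n cosD sinD.
  have := cos2Dsin2 t; move: (cos t) (sin t) => x y e.
  apply/rowP => i; rewrite !mxE.
  have -> : x * x = 1 - y * y by rewrite -e; ring.
  ring.
have [n1 f1 fn] := radial_forward s.
have -> : dot p p = (2 * r * sin t) ^+ 2.
  rewrite ep dotZl dotZr !dotDl !dotDr !dotNl !dotNr !dotZl !dotZr (dotC (radial s)).
  rewrite n1 f1 fn.
  transitivity ((2 * r * sin t) ^+ 2 * (cos t ^+ 2 + sin t ^+ 2)); first by ring.
  by rewrite cos2Dsin2 mulr1.
have r1 : r != 0 by rewrite lt0r_neq0.
rewrite ep; apply/rowP => i; rewrite !mxE; field.
by rewrite st.
Qed.

End Circle.

End Circles.

(** * Oriented circles through three points and their tangents *)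

Section Passing.
Variable R : realType.
Implicit Types (C : ocircle R) (x y z w : quaternion R).

Lemma passes_rot C x y z : passes C x y z -> passes C y z x.
Proof.
move=> [s1 [s2 [s3 [e1 e2 e3 h]]]]; case: C e1 e2 e3 h.
  move=> c r u v r0 uu vv uv e1 e2 e3 [h1 h2 h3].
  exists s2, s3, (s1 + pi *+ 2); split=> //; last by split=> //; lra.
  by rewrite /= cosD2pi sinD2pi.
move=> a d d0 e1 e2 e3 h; exists s2, s3, s1; split=> //.
by case: h => h; [apply: Or33 | apply: Or31 | apply: Or32].
Qed.

Lemma inverted_chord_circle c u v r r0 uu vv uv s1 s2
    (C := @OCircle R c r u v r0 uu vv uv) : s1 < s2 -> s2 < s1 + pi *+ 2 ->
  let t := (s2 - s1) / 2 in 0 < sin t /\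
  qconj ((param C s2 - param C s1 : quaternion R)^-1) =
  (2 * r)^-1 *: ((cos t / sin t) *: forward u v s1 - radial u v s1).
Proof.
move=> h1 h2 t.
have st : 0 < sin t by apply: sin_gt0_pi; rewrite /t; apply/andP; split; lra.
split=> //; rewrite conjV.
have e : s2 = s1 + t *+ 2 by rewrite /t; lra.
by rewrite [in LHS]e; apply: inverted_chord; rewrite lt0r_neq0.
Qed.

Lemma tangent_line (a d : 'rV[R]_4) (d0 : d != 0) s :
  tangent (OLine a d0) (param (OLine a d0) s) = d.
Proof.
rewrite /tangent; case: xgetP => [t _ [s' /= e <-]|]; first exact: derive1_line.
by move=> /(_ d)[]; exists s => //=; rewrite derive1_line.
Qed.

(** Inversion at [x] turns the circle into a line along the tangent; the cyclic order of the points
    decides the sign of the difference of the images of [y] and [z]. *)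
Lemma tangent_direction C x y z : passes C x y z ->
  exists2 k, 0 < k & tangent C x = k *: qconj (direction x y z).
Proof.
move=> [s1 [s2 [s3 [<- <- <-]]]]; rewrite /direction qconjB.
case: C => [c r u v r0 uu vv uv [h1 h2 h3]|a d d0 h].
  rewrite tangent_circle.
  have [p2 ->] := @inverted_chord_circle c u v r r0 uu vv uv _ _ h1 (lt_trans h2 h3).
  have [p3 ->] := @inverted_chord_circle c u v r r0 uu vv uv _ _ (lt_trans h1 h2) h3.
  move: p2 p3; set t2 := (s2 - s1) / 2; set t3 := (s3 - s1) / 2 => p2 p3.
  have p23 : 0 < sin (t3 - t2).
    by apply: sin_gt0_pi; rewrite /t2 /t3; apply/andP; split; lra.
  (* From cot t2 - cot t3 = sin (t3 - t2) / (sin t2 sin t3), the factor 1 / (2 r) of the inverted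
     chords and the speed r. *)
  exists (2 * r ^+ 2 * sin t2 * sin t3 / sin (t3 - t2)).
    by rewrite divr_gt0 // !mulr_gt0 // exprn_gt0.
  have q2 := lt0r_neq0 p2; have q3 := lt0r_neq0 p3; have q23 := lt0r_neq0 p23.
  have r1 := lt0r_neq0 r0.
  move: q23; rewrite sinB => q23.
  by apply/rowP => i; rewrite !mxE; field; rewrite q2 q3 q23 r1.
rewrite tangent_line /=.
have dd : dot d d != 0 by rewrite dot_eq0.
have dd0 : 0 < dot d d by rewrite dot_gt0.
have E s : a + s *: d - (a + s1 *: d) = (s - s1) *: d.
  by apply/rowP => i; rewrite !mxE; ring.
rewrite !conjV !E !dotZl !dotZr.
(* From 1 / (s2 - s1) - 1 / (s3 - s1) = (s3 - s2) / ((s2 - s1) (s3 - s1)); positive in each of the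
   three cyclic orders. *)
exists (dot d d * ((s2 - s1) * (s3 - s1) / (s3 - s2))).
  rewrite mulr_gt0 //; case: h => /andP[h1 h2].
  - by rewrite divr_gt0 // ?mulr_gt0 // subr_gt0 // (lt_trans h1 h2).
  - rewrite -mulrA nmulr_rgt0 ?subr_lt0 ?(lt_trans h1 h2) //.
    by rewrite nmulr_rlt0 ?subr_lt0 // invr_gt0 subr_gt0.
  - rewrite -mulrA mulr_gt0 ?subr_gt0 // -mulrNN mulr_gt0 ?oppr_gt0 ?subr_lt0 //.
    by rewrite invr_lt0 subr_lt0 (lt_trans h1 h2).
have n21 : s2 - s1 != 0 by rewrite subr_eq0; case: h => /andP[h1 h2];
  rewrite ?(gt_eqF h1) ?(gt_eqF (lt_trans h1 h2)) ?(lt_eqF (lt_trans h1 h2)) ?(gt_eqF h2).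
have n31 : s3 - s1 != 0 by rewrite subr_eq0; case: h => /andP[h1 h2];
  rewrite ?(gt_eqF (lt_trans h1 h2)) ?(lt_eqF h2) ?(lt_eqF h1).
have n32 : s3 - s2 != 0 by rewrite subr_eq0; case: h => /andP[h1 h2];
  rewrite ?(gt_eqF h2) ?(gt_eqF h1) ?(lt_eqF (lt_trans h1 h2)).
by apply/rowP => i; rewrite !mxE; field; rewrite n21 n31 n32 dd.
Qed.

(** Converse of [inverted_chord]: the inversion sends the line back into the circle. *)
Lemma carrier_circle c u v r r0 uu vv uv s w k
    (C := @OCircle R c r u v r0 uu vv uv) : w != param C s ->
  (dot (w - param C s) (w - param C s))^-1 *: (w - param C s) =
    (2 * r)^-1 *: (k *: forward u v s - radial u v s) ->
  carrier C w.
Proof.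
move=> wx; set q : quaternion R := w - param C s => h.
have d0 : dot q q != 0 by rewrite dot_eq0 subr_eq0.
have r1 := lt0r_neq0 r0.
have k1 : k ^+ 2 + 1 != 0 by rewrite lt0r_neq0 // ltr_wpDl // sqr_ge0.
have qq : dot q q = (2 * r) ^+ 2 / (k ^+ 2 + 1).
  have : (dot q q)^-1 = ((2 * r)^-1) ^+ 2 * (k ^+ 2 + 1).
    transitivity (dot ((dot q q)^-1 *: q) ((dot q q)^-1 *: q)).
      by rewrite dotZl dotZr mulVf ?mulr1.
    have [n1 f1 fn] := radial_forward uu vv uv s.
    rewrite h dotZl dotZr !dotDl !dotDr !dotNl !dotNr !dotZl !dotZr.
    by rewrite (dotC (radial u v s)) n1 f1 fn; ring.
  by move=> e; rewrite -[LHS]invrK e; field; rewrite r1 k1.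
(* These are the cosine and sine of 2 t when k = cot t. *)
have pq : ((k ^+ 2 - 1) / (k ^+ 2 + 1)) ^+ 2 + (2 * k / (k ^+ 2 + 1)) ^+ 2 = 1.
  by field.
have [t et] := @exists_param_circle R c u v r r0 uu vv uv s _ _ pq.
exists (s + t) => //; rewrite -et.
have -> : w = param C s + dot q q *: ((dot q q)^-1 *: q).
  by rewrite scalerA mulfV // scale1r /q addrC subrK.
rewrite h qq param_circle.
by apply/rowP => i; rewrite !mxE; field; rewrite r1 k1.
Qed.

(** After inversion at [x] the circle is the line through the image of [y] along [direction x y z],
    so a point whose image is on that line is on the circle. *)
Lemma carrier_of_direction C x y z w m : passes C x y z -> w != x ->
  (w - x)^-1 = (y - x)^-1 + m *: direction x y z -> carrier C w.
Proof.
move=> p wx h; have [k k0 T] := tangent_direction p.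
have {}h : (dot (w - x) (w - x))^-1 *: (w - x) =
    qconj (y - x)^-1 + (m / k) *: tangent C x.
  rewrite -conjV h T scalerA mulfVK ?lt0r_neq0 // -qconjZ.
  exact: qconjD.
move: p => [s1 [s2 [s3 [ex ey ez o]]]].
move: wx h {T}; rewrite -{}ex -{}ey => wx h {ez}.
case: C o wx h => [c r u v r0 uu vv uv|a d d1] o wx h.
  case: o => h1 h2 h3.
  have [p2 e2] := @inverted_chord_circle c u v r r0 uu vv uv _ _ h1 (lt_trans h2 h3).
  apply: carrier_circle wx _.
  rewrite {}h e2 tangent_circle.
  set t := (s2 - s1) / 2; have r1 := lt0r_neq0 r0.
  have -> : (m / k) *: (r *: forward u v s1) =
      (2 * r)^-1 *: ((2 * r ^+ 2 * m / k) *: forward u v s1).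
    by rewrite !scalerA; congr (_ *: _); field; rewrite r1 lt0r_neq0.
  rewrite -scalerDr addrAC -scalerDl; reflexivity.
move: wx h; rewrite tangent_line /=; set x0 : quaternion R := a + s1 *: d => wx h.
have d0 : dot (w - x0) (w - x0) != 0 by rewrite dot_eq0 subr_eq0.
move: h; rewrite conjV.
have -> : a + s2 *: d - x0 = (s2 - s1) *: d.
  by rewrite /x0; apply/rowP => i; rewrite !mxE; ring.
rewrite scalerA -scalerDl; set l := (X in X *: d) => h.
exists (s1 + dot (w - x0) (w - x0) * l) => //=.
rewrite scalerDl -scalerA -h scalerA mulfV // scale1r addrA -/x0.
by rewrite addrC subrK.
Qed.

Definition reverse C : ocircle R :=
  match C with
  | OCircle c r u v r0 uu vv uv =>
      OCircle c r0 uu (etrans (dot_opp v v) vv)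
        (etrans (dotNr u v) (etrans (congr1 -%R uv) (oppr0 _)))
  | OLine a d d0 => OLine a (etrans (congr1 negb (oppr_eq0 d)) d0)
  end.

Lemma carrier_reverse C : carrier (reverse C) = carrier C.
Proof.
apply/seteqP; split=> x [s _ <-]; exists (- s) => //;
  case: C => [c r u v r0 uu vv uv|a d d0] /=;
  by rewrite ?cosN ?sinN ?scaleNr ?scalerN ?opprK ?mulrN ?scaleNr ?opprK.
Qed.

Lemma passes_reverse C x y z : passes C x z y -> passes (reverse C) x y z.
Proof.
move=> [s1 [s3 [s2 [<- <- <-]]]].
case: C => [c r u v r0 uu vv uv [h1 h2 h3]|a d d0 h].
  exists (- s1), (- s2 + pi *+ 2), (- s3 + pi *+ 2); split.
  - by rewrite /= cosN sinN mulrN scaleNr scalerN opprK.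
  - by rewrite /= cosD2pi sinD2pi cosN sinN mulrN scaleNr scalerN opprK.
  - by rewrite /= cosD2pi sinD2pi cosN sinN mulrN scaleNr scalerN opprK.
  - by split; lra.
exists (- s1), (- s2), (- s3); rewrite /= !scaleNr !scalerN !opprK; split=> //.
rewrite !ltrN2; case: h => /andP[h1 h2].
- by apply: Or32; rewrite h1 h2.
- by apply: Or31; rewrite h1 h2.
- by apply: Or33; rewrite h1 h2.
Qed.

Lemma passes_or C x y z : carrier C x -> carrier C y -> carrier C z ->
  x != y -> x != z -> y != z -> passes C x y z \/ passes C x z y.
Proof.
move=> [s1 _ <-] [s2 _ <-] [s3 _ <-].
case: C => [c r u v r0 uu vv uv|a d d0] n12 n13 n23.
  have [t2 [l2 u2 e2]] := param_after n12.
  have [t3 [l3 u3 e3]] := param_after n13.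
  have [h|h|h] := ltrgtP t2 t3.
  - by left; exists s1, t2, t3.
  - by right; exists s1, t3, t2.
  by move: n23; rewrite -e2 -e3 h eqxx.
have n s t : param (OLine a d0) s != param (OLine a d0) t -> s != t.
  by apply: contra_neq => ->.
have := n _ _ n12; have := n _ _ n13; have := n _ _ n23.
have [h23|h23|//] := ltrgtP s2 s3; have [h13|h13|//] := ltrgtP s1 s3;
  have [h12|h12|//] := ltrgtP s1 s2 => _ _ _.
all: try (by left; exists s1, s2, s3; split=> //; 
  first [apply: Or31; lra | apply: Or32; lra | apply: Or33; lra]).
all: try (by right; exists s1, s3, s2; split=> //; 
  first [apply: Or31; lra | apply: Or32; lra | apply: Or33; lra]).
Qed.

Lemma exists_oriented S x y z : is_circle S -> S x -> S y -> S z ->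
  x != y -> x != z -> y != z -> exists2 C, carrier C = S & passes C x y z.
Proof.
move=> [C <-] Sx Sy Sz xy xz yz.
have [p|p] := passes_or Sx Sy Sz xy xz yz; first by exists C.
by exists (reverse C); [apply: carrier_reverse | apply: passes_reverse].
Qed.

End Passing.

(** * Tangents of a configuration with multi-ratio -1 *)

Section Table.
Variable R : realType.
Implicit Types x y z : quaternion R.

Lemma direction_inv3 x y z : x != 0 -> y != 0 -> z != 0 -> x != y -> x != z ->
  direction x^-1 y^-1 z^-1 = x * ((x - y)^-1 - (x - z)^-1) * x.
Proof. by move=> x0 y0 z0 xy xz; apply: direction_inv; apply: invqB_inv. Qed.

Lemma direction_inv0l x z : x != 0 -> z != 0 -> x != z ->
  direction x^-1 0 z^-1 = x * - (x - z)^-1 * x.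
Proof.
move=> x0 z0 xz; rewrite -[- _]sub0r.
by apply: direction_inv; [apply: sub0Vq | apply: invqB_inv].
Qed.

Lemma direction_inv0r x y : x != 0 -> y != 0 -> x != y ->
  direction x^-1 y^-1 0 = x * (x - y)^-1 * x.
Proof.
move=> x0 y0 xy; rewrite -[X in _ * X * _]subr0.
by apply: direction_inv; [apply: invqB_inv | apply: sub0Vq].
Qed.

Lemma direction_0 x y : direction 0 x^-1 y^-1 = x - y.
Proof. by rewrite /direction !subr0 !invrK. Qed.

Variables a b a' b' c : quaternion R.
Let s0 : quaternion R := b - a.
Let s1 : quaternion R := a' - b.
Let s2 : quaternion R := a - b'.
Let s3 : quaternion R := b' - a'.
Let S : quaternion R := s0 + s3.

(* The direction at infinity of the line which represents the circle of class [k]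
   through Phi_13. *)
Definition side (k : bool * bool) : quaternion R :=
  match k with
  | (false, false) => b - a | (true, false) => a' - b
  | (false, true) => a - b' | (true, true) => b' - a'
  end.

Definition inverted_points (v : vertex) : quaternion R :=
  match v with
  | V14 => a^-1 | V12 => b^-1 | V24 => c^-1
  | V23 => a'^-1 | V34 => b'^-1 | V13 => 0
  end.

Hypotheses (a0 : a != 0) (b0 : b != 0) (a'0 : a' != 0) (b'0 : b' != 0)
  (c0 : c != 0).
Hypotheses (ab : a != b) (ba' : b != a') (a'b' : a' != b') (b'a : b' != a)
  (ac : a != c) (bc : b != c) (a'c : a' != c) (b'c : b' != c).
Hypotheses (S0 : S != 0) (hca : c - a = - (s2 * S^-1 * s0))
  (hcb : c - b = s1 * S^-1 * s0) (hca' : c - a' = - (s1 * S^-1 * s3))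
  (hcb' : c - b' = s2 * S^-1 * s3).

(** At a vertex x among a, b, a', b', where the sides u (one of s0, s3) and v (one of s1, s2) meet,
    the factors are x u^-1 and v^-1 x. At Phi_13 they are 1. *)
Lemma directions_at_vertex v : exists p q : quaternion R, [/\ p != 0, q != 0 &
  forall w u : vertex, positive v w u ->
    direction (inverted_points v) (inverted_points w) (inverted_points u) =
    p * side (class_of [set v; w; u]%SET v) * q].
Proof.
have s00 : s0 != 0 by rewrite subr_eq0 eq_sym.
have s10 : s1 != 0 by rewrite subr_eq0 eq_sym.
have s20 : s2 != 0 by rewrite subr_eq0 eq_sym.
have s30 : s3 != 0 by rewrite subr_eq0 eq_sym.
have [ba b'a' a'b ab'] : [/\ b != a, b' != a', a' != b & a != b'].
  by split; rewrite eq_sym; [exact: ab|exact: a'b'|exact: ba'|exact: b'a].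
have [ca cb ca' cb'] : [/\ c != a, c != b, c != a' & c != b'].
  by split; rewrite eq_sym; [exact: ac|exact: bc|exact: a'c|exact: b'c].
have inv0 x : x != 0 -> x^-1 != 0 by rewrite invq_eq0.
have flip x y : (y - x)^-1 = - (x - y)^-1 by rewrite -opprB invrN.
pose e := (flip b a, flip a' b, flip a b', flip b' a', flip c a, flip c b,
  flip c a', flip c b').
have ea : (c - a)^-1 = - (s0^-1 * S * s2^-1).
  by rewrite hca invrN (invqM3 s20 (inv0 _ S0) s00) invrK.
have eb : (c - b)^-1 = s0^-1 * S * s1^-1.
  by rewrite hcb (invqM3 s10 (inv0 _ S0) s00) invrK.
have ea' : (c - a')^-1 = - (s3^-1 * S * s1^-1).
  by rewrite hca' invrN (invqM3 s10 (inv0 _ S0) s30) invrK.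
have eb' : (c - b')^-1 = s3^-1 * S * s2^-1.
  by rewrite hcb' (invqM3 s20 (inv0 _ S0) s30) invrK.
have d1 : S - s0 = s3 by rewrite /S addrC addKr.
have d2 : S - s3 = s0 by rewrite /S addrK.
have d3 : - S - s1 = s2.
  by rewrite /S /s0 /s1 /s2 /s3; apply/rowP => i; rewrite !mxE; ring.
have d4 : - S - s2 = s1.
  by rewrite /S /s0 /s1 /s2 /s3; apply/rowP => i; rewrite !mxE; ring.
have sandwich x u t y : x * (u * t * y) * x = x * u * t * (y * x).
  by rewrite !mulrA.
case: v.
- have [k1 k2 k3 k4] := side_combinations S s00 s10; rewrite d1 d3 in k3 k4.
  exists (b * s0^-1), (s1^-1 * b); split.
  - exact: mulq_neq0 b0 (inv0 _ s00).
  - exact: mulq_neq0 (inv0 _ s10) b0.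
  move=> w u; case: w => //; case: u => //= _; rewrite /class_of !inE /=;
    rewrite (direction_inv3 b0 c0 a0 bc ba, direction_inv0r b0 a0 ba,
      direction_inv0l b0 a'0 ba', direction_inv3 b0 a'0 c0 ba' bc);
    rewrite -sandwich; congr (_ * _ * _); rewrite ?e;
    rewrite ?ea ?eb ?ea' ?eb' -/s0 -/s1 -/s2 -/s3 ?(k1, k2, k3, k4) ?opprK //;
    by rewrite addrC.
- exists 1, 1; split; rewrite ?oner_neq0 //.
  move=> w u; rewrite mul1r mulr1; case: w => //; case: u => //= _;
    by rewrite /class_of !inE /= direction_0.
- have [k1 k2 k3 k4] := side_combinations S s00 s20; rewrite d1 d4 in k3 k4.
  exists (a * s0^-1), (s2^-1 * a); split.
  - exact: mulq_neq0 a0 (inv0 _ s00).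
  - exact: mulq_neq0 (inv0 _ s20) a0.
  move=> w u; case: w => //; case: u => //= _; rewrite /class_of !inE /=;
    rewrite (direction_inv3 a0 b0 c0 ab ac, direction_inv3 a0 c0 b'0 ac ab',
      direction_inv0r a0 b'0 ab', direction_inv0l a0 b0 ab);
    rewrite -sandwich; congr (_ * _ * _); rewrite ?e;
    rewrite ?ea ?eb ?ea' ?eb' -/s0 -/s1 -/s2 -/s3 ?(k1, k2, k3, k4) ?opprK //;
    by rewrite addrC.
- have [k1 k2 k3 k4] := side_combinations S s30 s10; rewrite d2 d3 in k3 k4.
  exists (a' * s3^-1), (s1^-1 * a'); split.
  - exact: mulq_neq0 a'0 (inv0 _ s30).
  - exact: mulq_neq0 (inv0 _ s10) a'0.
  move=> w u; case: w => //; case: u => //= _; rewrite /class_of !inE /=;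
    rewrite (direction_inv0r a'0 b0 a'b, direction_inv0l a'0 b'0 a'b',
      direction_inv3 a'0 b'0 c0 a'b' a'c, direction_inv3 a'0 c0 b0 a'c a'b);
    rewrite -sandwich; congr (_ * _ * _); rewrite ?e;
    rewrite ?ea ?eb ?ea' ?eb' -/s0 -/s1 -/s2 -/s3 ?(k1, k2, k3, k4) ?opprK //;
    by rewrite addrC.
(* At [c] the products K = s0^-1 S s3^-1 and L = s1^-1 S s2^-1 may each be read in the opposite
   order too, so that every side cancels against an adjacent inverse. *)
- pose K := s0^-1 + s3^-1; pose L := s1^-1 * S * s2^-1.
  have K1 : K = s0^-1 * S * s3^-1 by rewrite /K invqD // /S addrC.
  have K2 : K = s3^-1 * S * s0^-1 by rewrite /K addrC invqD.
  have S12 : s2 + s1 = - S by rewrite -d3 subrK.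
  have L0 : L = - (s1^-1 + s2^-1).
    by rewrite invqD // S12 mulrN mulNr opprK.
  have L2 : L = s2^-1 * S * s1^-1.
    by rewrite L0 addrC invqD // addrC S12 mulrN mulNr opprK.
  have m3 : K * s3 * L = - (s0^-1 * S * s2^-1) - s0^-1 * S * s1^-1.
    by rewrite K1 mulrVK // L0 mulrN mulrDr opprD addrC.
  have m0 : K * s0 * L = - (s3^-1 * S * s1^-1) - s3^-1 * S * s2^-1.
    by rewrite K2 mulrVK // L0 mulrN mulrDr opprD.
  have m1 : K * s1 * L = s3^-1 * S * s2^-1 + s0^-1 * S * s2^-1.
    by rewrite /L !mulrA mulrK // /K !mulrDl addrC.
  have m2 : K * s2 * L = s0^-1 * S * s1^-1 + s3^-1 * S * s1^-1.
    by rewrite L2 !mulrA mulrK // /K !mulrDl.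
  exists (c * K), (L * c); split.
  - rewrite K1; apply: mulq_neq0 c0 _.
    exact: mulq_neq0 (mulq_neq0 (inv0 _ s00) S0) (inv0 _ s30).
  - exact: mulq_neq0 (mulq_neq0 (mulq_neq0 (inv0 _ s10) S0) (inv0 _ s20)) c0.
  move=> w u; case: w => //; case: u => //= _; rewrite /class_of !inE /=;
    rewrite (direction_inv3 c0 a0 b0 ca cb, direction_inv3 c0 b0 a'0 cb ca',
      direction_inv3 c0 a'0 b'0 ca' cb', direction_inv3 c0 b'0 a0 cb' ca) -sandwich;
    congr (_ * _ * _);
    by rewrite -/s0 -/s1 -/s2 -/s3 ?(m0, m1, m2, m3) ?ea ?eb ?ea' ?eb' ?opprK.
- have [k1 k2 k3 k4] := side_combinations S s30 s20; rewrite d2 d4 in k3 k4.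
  exists (b' * s3^-1), (s2^-1 * b'); split.
  - exact: mulq_neq0 b'0 (inv0 _ s30).
  - exact: mulq_neq0 (inv0 _ s20) b'0.
  move=> w u; case: w => //; case: u => //= _; rewrite /class_of !inE /=;
    rewrite (direction_inv0l b'0 a0 b'a, direction_inv3 b'0 a0 c0 b'a b'c,
      direction_inv3 b'0 c0 a'0 b'c b'a', direction_inv0r b'0 a'0 b'a');
    rewrite -sandwich; congr (_ * _ * _); rewrite ?e;
    rewrite ?ea ?eb ?ea' ?eb' -/s0 -/s1 -/s2 -/s3 ?(k1, k2, k3, k4) ?opprK //;
    by rewrite addrC.
Qed.
End Table.

(** * The two multi-ratio conditions and the cosines of directions *)

Section Multiratio.
Variable R : realType.
Implicit Types (P : vertex -> quaternion R).

Lemma multiratio_translate t (x1 x2 x3 x4 x5 x6 : quaternion R) :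
  multiratio (x1 - t) (x2 - t) (x3 - t) (x4 - t) (x5 - t) (x6 - t) =
  multiratio x1 x2 x3 x4 x5 x6.
Proof.
have e (x y : quaternion R) : (x - t) - (y - t) = x - y.
  by rewrite opprB addrA subrK.
by rewrite /multiratio !e.
Qed.

(** Conjugation reverses the product, and the six changes of sign cancel. *)
Lemma multiratio_tilde_conj (x1 x2 x3 x4 x5 x6 : quaternion R) :
  multiratio_tilde x1 x2 x3 x4 x5 x6 =
  qconj (multiratio (qconj x1) (qconj x2) (qconj x3)
                    (qconj x4) (qconj x5) (qconj x6)).
Proof.
rewrite /multiratio -!qconjB -!qconjV -!qconjM qconjK /multiratio_tilde.
rewrite !qmulE !qinvE -!mulrA.
rewrite -(opprB x6 x1) -(opprB x5 x6) -(opprB x4 x5) -(opprB x3 x4).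
by rewrite -(opprB x2 x3) -(opprB x1 x2) !invrN !(mulNr, mulrN) !opprK.
Qed.

Lemma directions_of_multiratio P : injective P ->
  multiratio (P V14) (P V12) (P V24) (P V23) (P V34) (P V13) = - qone ->
  exists s : bool * bool -> quaternion R, forall v,
  exists p q : quaternion R, [/\ p != 0, q != 0 &
  forall w x, positive v w x ->
    direction (P v) (P w) (P x) = p * s (class_of [set v; w; x]%SET v) * q].
Proof.
move=> injP; rewrite -(multiratio_translate (P V13)) subrr.
pose Q v := (P v - P V13)^-1.
have QK v : P v - P V13 = (Q v)^-1 by rewrite invrK.
have Q0 v : v != V13 -> Q v != 0 by rewrite invq_eq0 subr_eq0 (inj_eq injP).
have Qn v w : v != w -> Q v != Q w.
  by apply: contra_neq => /invr_inj /addIr; apply: injP.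
have [a0 b0 a'0 b'0 c0] : [/\ Q V14 != 0, Q V12 != 0, Q V23 != 0,
  Q V34 != 0 & Q V24 != 0] by split; apply: Q0.
have [ab ba' a'b' b'a] : [/\ Q V14 != Q V12, Q V12 != Q V23,
  Q V23 != Q V34 & Q V34 != Q V14] by split; apply: Qn.
have [ac bc a'c b'c] : [/\ Q V14 != Q V24, Q V12 != Q V24,
  Q V23 != Q V24 & Q V34 != Q V24] by split; apply: Qn.
rewrite !QK => h.
have [S0 ea eb ea' eb'] := normal_form a0 b0 a'0 b'0 c0 ab ba' a'b' bc h.
exists (side (Q V14) (Q V12) (Q V23) (Q V34)) => v.
have [p [q [p0 q0 {}h]]] := directions_at_vertex
  a0 b0 a'0 b'0 c0 ab ba' a'b' b'a ac bc a'c b'c S0 ea eb ea' eb' v.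
exists p, q; split=> // w x pos; rewrite -h // -(direction_translate (P V13)).
(* At [V13] the inverse is taken of 0 and gives 0, the value in [inverted_points]. *)
have e u : P u - P V13 = inverted_points (Q V14) (Q V12) (Q V23) (Q V34) (Q V24) u.
  by case: u; rewrite /= ?QK // /Q subrr !invr0.
by rewrite !e.
Qed.

Lemma cosines_of_multiratio P : injective P ->
  multiratio (P V14) (P V12) (P V24) (P V23) (P V34) (P V13) = - qone \/
  multiratio_tilde (P V14) (P V12) (P V24) (P V23) (P V34) (P V13) = - qone ->
  exists s : bool * bool -> quaternion R,
  forall v w x w' x', positive v w x -> positive v w' x' ->
    cosine (direction (P v) (P w) (P x)) (direction (P v) (P w') (P x')) =
    cosine (s (class_of [set v; w; x]%SET v)) (s (class_of [set v; w'; x']%SET v)).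
Proof.
(* The condition on the other multi-ratio becomes this one for the conjugate points, and conjugation
   keeps cosines. *)
wlog : P / multiratio (P V14) (P V12) (P V24) (P V23) (P V34) (P V13) = - qone.
  move=> hw injP [] h; first by apply: hw => //; left.
  have h' : multiratio (qconj (P V14)) (qconj (P V12)) (qconj (P V24))
      (qconj (P V23)) (qconj (P V34)) (qconj (P V13)) = - qone.
    by rewrite -qconj_opp1 -h multiratio_tilde_conj qconjK.
  have [||s hs] := hw (@qconj R \o P) h'; last 2 first.
  - by left.
  - exists s => v w x w' x' p p'; rewrite -hs // !direction_conj.
    by rewrite cosine_conj.
  by apply: inj_comp => //; apply: can_inj (@qconjK R).
move=> h injP _; have [s hs] := directions_of_multiratio injP h; exists s.
move=> v w x w' x' p p'; have [l [r [l0 r0 e]]] := hs v.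
by rewrite !e // cosineM.
Qed.

End Multiratio.

Lemma positive_rot v w x v' w' x' : positive v w x -> positive v' w' x' ->
  [set v; w; x]%SET = [set v'; w'; x']%SET ->
  [\/ (v', w', x') = (v, w, x), (v', w', x') = (w, x, v) |
      (v', w', x') = (x, v, w)].
Proof.
move=> p p' /setP h; have := h v'; have := h w'; have := h x'.
rewrite !inE !eqxx !orbT /= => h1 h2 h3; move: p p' h1 h2 h3 {h}.
case: v; case: w => //; case: x => //= _; case: v' => //;
  case: w' => //; case: x' => //= *; by [apply: Or31|apply: Or32|apply: Or33].
Qed.

(** * From multi-ratio -1 to equal angles *)

Section Converse.
Variable R : realType.
Implicit Types (Phi : vertex -> quaternion R) (Gamma : face -> set (quaternion R)).

(** The two orders would give nonzero tangents at [x] pointing in opposite directions. *)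
Lemma passes_asym (C : ocircle R) (x y z : quaternion R) :
  x != y -> x != z -> y != z -> passes C x y z -> ~ passes C x z y.
Proof.
move=> xy xz yz /tangent_direction[k k0 e] /tangent_direction[l l0].
rewrite e (directionC x y z) => h.
have : (k + l) *: qconj (direction x y z) = 0.
  by rewrite scalerDl h qconjN scalerN addNr.
move/eqP; rewrite scaler_eq0 gt_eqF ?addr_gt0 //= -dot_eq0 dot_conj dot_eq0.
by rewrite (negPf (direction_neq0 xy xz yz)).
Qed.

Lemma oriented_circle Phi Gamma f : octahedral_configuration Phi Gamma ->
  forall v w x, val f = [set v; w; x]%SET -> w != x -> v != w -> v != x ->
  exists2 C, carrier C = Gamma f & passes C (Phi v) (Phi w) (Phi x).
Proof.
move=> [injP circ inc] v w x ef wx vw vx.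
by apply: exists_oriented; rewrite ?(inj_eq injP) //; apply/inc;
  rewrite ef !inE eqxx ?orbT.
Qed.

Lemma positive_neq v w x : positive v w x -> [/\ v != w, v != x & w != x].
Proof. by case: v; case: w => //; case: x. Qed.

Lemma oriented_face Phi Gamma f : octahedral_configuration Phi Gamma ->
  exists C, carrier C = Gamma f /\
  forall v w x, positive v w x -> val f = [set v; w; x]%SET ->
    passes C (Phi v) (Phi w) (Phi x).
Proof.
move=> conf; have [v vf] : exists v, v \in val f.
  have := mem_face f V23; case h : (V14 \in val f) => /= h'.
    by exists V14.
  by exists V23.
have [w [x [ef p]]] := exists_positive vf.
have [vw vx wx] := positive_neq p.
have [C eC pC] := oriented_circle conf ef wx vw vx.
exists C; split=> // v' w' x' p' ef'; move: ef; rewrite ef' => /esym ef.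
by case: (positive_rot p p' ef) => -[-> -> ->];
  by [|apply: passes_rot|do 2!apply: passes_rot].
Qed.

Lemma circle_angleE (C D : ocircle R) (x y z y' z' : quaternion R) :
  passes C x y z -> passes D x y' z' ->
  circle_angle C D x = acos (cosine (direction x y z) (direction x y' z')).
Proof.
move=> /tangent_direction[k k0 e] /tangent_direction[l l0 e'].
rewrite /circle_angle e e' -[angle _ _]/(acos (cosine _ _)).
by rewrite cosineZ // cosine_conj.
Qed.

Theorem clifford_of_multiratio Phi Gamma : octahedral_configuration Phi Gamma ->
  multiratio (Phi V14) (Phi V12) (Phi V24) (Phi V23) (Phi V34) (Phi V13) = - qone \/
  multiratio_tilde (Phi V14) (Phi V12) (Phi V24) (Phi V23) (Phi V34) (Phi V13) = - qone ->
  generalized_clifford Phi Gamma.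
Proof.
move=> conf M; split=> //; have [injP circ inc] := conf.
have [s hs] := cosines_of_multiratio injP M.
have [C hC] := choice (fun f => oriented_face f conf).
have pos (f : face) v w x : positive v w x -> val f = [set v; w; x]%SET ->
  passes (C f) (Phi v) (Phi w) (Phi x) by have [_] := hC f; apply.
exists C; split=> [f|f g v w a b fg ef eg p|]; first by have [] := hC f.
  have [pa|pa] := orP (face_triple ef).
    apply: pos (positive_adjacent fg ef eg pa) _.
    by rewrite eg (finset.setUC [set v]%SET).
  (* In the negative order the premise of coherence fails, since [C f] runs positively. *)
  have [va vw aw] := positive_neq pa.
  case: (@passes_asym (C f) (Phi v) (Phi w) (Phi a)) => //;
    rewrite ?(inj_eq injP) // 1?eq_sym //.
  by apply: pos => //; rewrite ef -!finset.setUA (finset.setUC [set w]%SET).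
have ang (f g : face) v : v \in val f -> v \in val g -> circle_angle (C f) (C g) (Phi v) =
    acos (cosine (s (class_of (val f) v)) (s (class_of (val g) v))).
  move=> /exists_positive[w [x [ef p]]] /exists_positive[w' [x' [eg p']]].
  by rewrite (circle_angleE (pos _ _ _ _ p ef) (pos _ _ _ _ p' eg)) ef eg -hs.
move=> f g f' g' v w /class_of_corr[/= vf wf' ef] /class_of_corr[/= vg wg' eg].
by rewrite !ang // ef eg.
Qed.

End Converse.

(** * Points of a generalized Clifford configuration *)

Section Dichotomy.
Variable R : realType.
Implicit Types x y z w p q : quaternion R.

(* Modulo the span of 1, x and y, the products [x * y] and [y * x] are
   opposite multiples of the cross product of the imaginary parts. *)
Lemma orthogonal_products x y w (h := w - x * y) :
  dot h (1 : quaternion R) = 0 -> dot h x = 0 -> dot h y = 0 ->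
  dot w w = dot (x * y) (x * y) ->
  w = x * y \/ w = y * x.
Proof.
move=> h1 hx hy; have ew : w = h + x * y by rewrite subrK.
clearbody h; move=> ww; pose k := y * x - x * y.
have h0 : h 0 (inord 0) = 0.
  by move: h1; rewrite dotE !quatE !mulr0 !addr0 mulr1.
(* The sum x y + y x lies in the span of 1, x and y. *)
have hs : dot h (x * y + y * x) = 0.
  transitivity (2 * x 0 (inord 0) * dot h y + 2 * y 0 (inord 0) * dot h x
     - 2 * dot x y * h 0 (inord 0)); last by rewrite hx hy h0; ring.
  rewrite dotDr -!qmulE !dotE !quatE; ring.
(* Equal norms put [h] on the sphere with diameter from 0 to [k]. *)
have hh : dot h h = dot h k.
  have : dot w w = dot h h + 2 * dot h (x * y) + dot (x * y) (x * y).
    have hc : dot (x * y) h = dot h (x * y) by apply: dotC.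
    by rewrite ew dotDl !dotDr hc; ring.
  rewrite ww; move: hs; rewrite /k dotDr [in dot h (_ - _)]dotDr dotNr; lra.
(* Both are imaginary and orthogonal to the imaginary parts of [x] and [y], and [k] is twice their
   cross product; hence the cross product of [k] and [h] vanishes. *)
have par : dot k k *: h = dot h k *: k.
  have k0 : k 0 (inord 0) = 0.
    by rewrite /k -!qmulE !mxE !inordK //=; ring.
  have [k1 k2 k3] : [/\ k 0 (inord 1) = 2 * (y 0 (inord 2) * x 0 (inord 3) -
      y 0 (inord 3) * x 0 (inord 2)),
      k 0 (inord 2) = 2 * (y 0 (inord 3) * x 0 (inord 1) -
      y 0 (inord 1) * x 0 (inord 3)) &
      k 0 (inord 3) = 2 * (y 0 (inord 1) * x 0 (inord 2) -
      y 0 (inord 2) * x 0 (inord 1))].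
    by rewrite /k -!qmulE !mxE !inordK //=; split; ring.
  move: hx hy; rewrite !dotE h0 !mul0r !add0r => hx hy.
  have vanish (c d z1 z2 t : R) : z1 = 0 -> z2 = 0 -> t = c * z1 + d * z2 -> t = 0.
    by move=> -> -> ->; rewrite !mulr0 addr0.
  have e12 : k 0 (inord 1) * h 0 (inord 2) - k 0 (inord 2) * h 0 (inord 1) = 0.
    apply: (vanish (2 * x 0 (inord 3)) (- 2 * y 0 (inord 3)) _ _ _ hy hx).
    by rewrite k1 k2; ring.
  have e23 : k 0 (inord 2) * h 0 (inord 3) - k 0 (inord 3) * h 0 (inord 2) = 0.
    apply: (vanish (2 * x 0 (inord 1)) (- 2 * y 0 (inord 1)) _ _ _ hy hx).
    by rewrite k2 k3; ring.
  have e31 : k 0 (inord 3) * h 0 (inord 1) - k 0 (inord 1) * h 0 (inord 3) = 0.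
    apply: (vanish (2 * x 0 (inord 2)) (- 2 * y 0 (inord 2)) _ _ _ hy hx).
    by rewrite k1 k3; ring.
  clearbody k; apply: quat_ext; rewrite !mxE k0 ?h0 ?mulr0 //;
    apply: subr0_eq.
  - by apply: (vanish (- k 0 (inord 2)) (k 0 (inord 3)) _ _ _ e12 e31); ring.
  - by apply: (vanish (k 0 (inord 1)) (- k 0 (inord 3)) _ _ _ e12 e23); ring.
  - by apply: (vanish (- k 0 (inord 1)) (k 0 (inord 2)) _ _ _ e31 e23); ring.
have [k0|k0] := eqVneq k 0.
  left; have /eqP : dot h h = 0 by rewrite hh k0 dot0r.
  by rewrite dot_eq0 ew => /eqP ->; rewrite add0r.
have kk : dot k k != 0 by rewrite dot_eq0.
have : dot (h - k) h = 0 by rewrite dotDl dotNl (dotC k) hh subrr.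
(* The line through 0 and [k] meets the sphere with that diameter only in 0 and [k]. *)
have [m eh] : exists m, h = m *: k.
  exists (dot h k / dot k k).
  by rewrite mulrC -scalerA -par scalerA mulVf // scale1r.
rewrite eh -{2}[k]scale1r -scalerBl dotZl dotZr => /eqP.
rewrite !mulf_eq0 (negPf kk) orbF subr_eq0 => /orP[] /eqP m1.
  by right; rewrite ew eh m1 scale1r subrK.
by left; rewrite ew eh m1 scale0r add0r.
Qed.

End Dichotomy.

(** * The position of [c] from its distances to the other four points *)

Section Distances.
Variable R : realType.
Implicit Types x y z w p q : quaternion R.

Lemma equidistant p q x y : enorm (p - x) = enorm (q - x) ->
  enorm (p - y) = enorm (q - y) -> dot (p - q) (x - y) = 0.
Proof.
have e z : dot (p - z) (p - z) = dot p p - 2 * dot p z + dot z z.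
  by rewrite dotDl !dotDr !dotNl !dotNr (dotC z p); ring.
have e' z : dot (q - z) (q - z) = dot q q - 2 * dot q z + dot z z.
  by rewrite dotDl !dotDr !dotNl !dotNr (dotC z q); ring.
move=> /(congr1 (fun t => t ^+ 2)) + /(congr1 (fun t => t ^+ 2)).
rewrite !enorm_sqr !e !e' dotDl !dotDr !dotNl !dotNr; lra.
Qed.

Variables a b a' b' c : quaternion R.
Let s0 : quaternion R := b - a.
Let s1 : quaternion R := a' - b.
Let s2 : quaternion R := a - b'.
Let s3 : quaternion R := b' - a'.
Let S : quaternion R := s0 + s3.

(** The distances are those of the point [c0] which satisfies the first alternative, so c - c0 is
    orthogonal to all sides; [orthogonal_products] then leaves two positions. *)
Lemma fifth_point : S != 0 ->
  enorm (c - a) * enorm S = enorm s0 * enorm s2 ->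
  enorm (c - b) * enorm S = enorm s0 * enorm s1 ->
  enorm (c - a') * enorm S = enorm s3 * enorm s1 ->
  enorm (c - b') * enorm S = enorm s3 * enorm s2 ->
  c - a = - (s2 * S^-1 * s0) \/ c - a = - (s0 * S^-1 * s2).
Proof.
move=> S0 ha hb ha' hb'.
pose c0 : quaternion R := a - s2 * S^-1 * s0.
have ca0 : c0 - a = - (s2 * S^-1 * s0) by rewrite /c0 addrC addKr.
have [cb0 ca'0 cb'0] := chords S0 ca0.
have uS : S \is a GRing.unit by rewrite qunitE.
have nS : enorm S != 0 by rewrite enorm_eq0.
have E (u v z : quaternion R) t : t * enorm S = enorm u * enorm v ->
    z = v * S^-1 * u \/ z = - (v * S^-1 * u) -> t = enorm z.
  move=> ht hz; apply: (mulIf nS); rewrite ht.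
  have -> : enorm z = enorm (v * S^-1 * u) by case: hz => ->; rewrite ?enormN.
  by rewrite !enormM enormV; field.
have qa : enorm (c - a) = enorm (c0 - a) by apply: E ha _; right.
have qb : enorm (c - b) = enorm (c0 - b) by apply: E hb _; left.
have qa' : enorm (c - a') = enorm (c0 - a') by apply: E ha' _; right.
have qb' : enorm (c - b') = enorm (c0 - b') by apply: E hb' _; left.
(* Multiplying by S^-1 on the right keeps orthogonality and turns S, s2, s0 into 1, x, y. *)
pose x := s2 * S^-1; pose y := s0 * S^-1; pose w := - (c - a) * S^-1.
have hw : w - x * y = - ((c - c0) * S^-1).
  rewrite /w /x /y mulrA -mulrBl -[RHS]mulNr !opprB.
  by congr (_ * _); rewrite /c0 addrAC.
have D z : dot (c - c0) z = 0 -> dot (w - x * y) (z * S^-1) = 0.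
  by move=> h; rewrite hw dotNl dotMr h mulr0 oppr0.
have d0 : dot (c - c0) s0 = 0 by apply: equidistant.
have d2 : dot (c - c0) s2 = 0 by apply: equidistant.
have d3 : dot (c - c0) s3 = 0 by apply: equidistant.
have [||h|h] := @orthogonal_products R x y w _ (D _ d2) (D _ d0).
- by rewrite -(mulrV uS); apply: D; rewrite dotDr d0 d3 addr0.
- have -> : x * y = - (c0 - a) * S^-1 by rewrite ca0 opprK /x /y mulrA.
  by rewrite !dotMr !dot_opp -!enorm_sqr qa.
- left; apply: oppr_inj; rewrite opprK -(mulrVK uS (- (c - a))) -/w h.
  by rewrite /x /y mulrA mulrVK.
- right; apply: oppr_inj; rewrite opprK -(mulrVK uS (- (c - a))) -/w h.
  by rewrite /x /y mulrA mulrVK.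
Qed.

End Distances.

(** * From the angles at one vertex to distances *)

Section Gram.
Variable R : realType.
Implicit Types s t : bool * bool -> quaternion R.

Lemma dot_cosine (p q : quaternion R) :
  dot p q = enorm p * enorm q * cosine p q.
Proof.
have [->|p0] := eqVneq p 0; first by rewrite dot0l /enorm dot0l sqrtr0 !mul0r.
have [->|q0] := eqVneq q 0; first by rewrite dot0r /enorm dot0r sqrtr0 mulr0 mul0r.
by rewrite /cosine mulrC divfK // mulf_neq0 // enorm_eq0.
Qed.

(* Equality of the angles makes the relation [\sum |s k| s k / |s k| = 0] hold
   for the unit vectors along [t]; it is then a multiple of the closing
   relation of [t], because the coefficients at [00] and [01] are
   proportional and [t 10] and [t 11] are independent. *)
Lemma proportional_gram s t :
  (forall k, t k != 0) ->
  (forall i j, cosine (t i) (t j) = cosine (s i) (s j)) ->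
  s (false, false) + s (true, false) + s (false, true) + s (true, true) = 0 ->
  t (false, false) + t (true, false) + t (false, true) + t (true, true) = 0 ->
  enorm (s (false, false)) * enorm (t (false, true)) =
    enorm (s (false, true)) * enorm (t (false, false)) ->
  (forall k l : R, k *: t (true, false) + l *: t (true, true) = 0 ->
     k = 0 /\ l = 0) ->
  let m := enorm (s (false, false)) / enorm (t (false, false)) in
  forall i j, dot (s i) (s j) = m ^+ 2 * dot (t i) (t j).
Proof.
move=> t0 st s_sum t_sum prop indep m.
pose r k := enorm (s k) / enorm (t k).
have tn k : enorm (t k) != 0 by rewrite enorm_eq0.
have rr i j : dot (r i *: t i) (r j *: t j) = dot (s i) (s j).
  by rewrite dotZl dotZr !dot_cosine st /r; field; rewrite !tn.
(* The vectors [r k *: t k] have the Gram matrix of [s], so their sum has norm 0 as well. *)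
have r_sum : r (false, false) *: t (false, false) + r (true, false) *: t (true, false) +
    r (false, true) *: t (false, true) + r (true, true) *: t (true, true) = 0.
  apply/eqP; rewrite -dot_eq0 !dotDl !dotDr !rr -!dotDr -!dotDl.
  by rewrite s_sum dot0l.
have r01 : r (false, true) = m.
  by apply/eqP; rewrite /r /m eqr_div // -prop mulrC.
have [r10 r11] : r (true, false) - m = 0 /\ r (true, true) - m = 0.
  apply: indep; move: r_sum; rewrite r01 -[r (false, false)]/m => r_sum.
  rewrite -[RHS]oppr0 -[in RHS](scaler0 _ m) -t_sum -[RHS]add0r -r_sum.
  by move: (r _) (r _) m {r01 r_sum} => u v m; apply/rowP => i; rewrite !mxE; ring.
have rm k : r k = m.
  by case: k => [] [] [] //; apply: subr0_eq.
by move=> i j; rewrite -rr !rm dotZl dotZr mulrA.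
Qed.

Lemma gram_add s t m :
  (forall i j, dot (s i) (s j) = m * dot (t i) (t j)) ->
  forall i j, dot (s i + s j) (s i + s j) = m * dot (t i + t j) (t i + t j).
Proof. by move=> h i j; rewrite !dotDl !dotDr !h; ring. Qed.

Variables a b a' b' c : quaternion R.
Let s0 : quaternion R := b - a.
Let s1 : quaternion R := a' - b.
Let s2 : quaternion R := a - b'.
Let s3 : quaternion R := b' - a'.
Let S : quaternion R := s0 + s3.

(* The tangent direction at [a] of the circle of class [k]; for two of the classes
   that circle is a line. *)
Definition star (k : bool * bool) : quaternion R :=
  match k with
  | (false, false) => (a - b')^-1
  | (true, false) => (a - b)^-1 - (a - c)^-1
  | (false, true) => - (a - b)^-1
  | (true, true) => (a - c)^-1 - (a - b')^-1
  end.

(** Proportional Gram matrices compare lengths of corresponding vectors: S corresponds to (a -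
    c)^-1, and s1, s3 correspond to tangents whose lengths contain |c - b| and |c - b'|. *)
Lemma distances_of_angles :
  a != b -> a != b' -> a != c -> b != c -> b' != c ->
  (forall i j, cosine (star i) (star j) =
    cosine (side a b a' b' i) (side a b a' b' j)) ->
  (forall k l : R, k *: star (true, false) + l *: star (true, true) = 0 ->
     k = 0 /\ l = 0) ->
  [/\ S != 0, enorm (c - a) * enorm S = enorm s0 * enorm s2,
      enorm (c - b) * enorm S = enorm s0 * enorm s1 &
      enorm (c - b') * enorm S = enorm s3 * enorm s2].
Proof.
move=> ab ab' ac bc b'c cs indep.
have nab : a - b != 0 by rewrite subr_eq0.
have nab' : a - b' != 0 by rewrite subr_eq0.
have nac : a - c != 0 by rewrite subr_eq0.
have t0 k : star k != 0.
  case: k => [] [] [] /=; rewrite ?oppr_eq0 ?invq_eq0 // subr_eq0;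
    by [apply: contra_neq b'c => /invr_inj/addrI/oppr_inj
       |apply: contra_neq bc => /invr_inj/addrI/oppr_inj].
have := proportional_gram t0 cs _ _ _ indep.
set m := _ / _ => /= G.
have em : m = enorm s0 * enorm s2 by rewrite /m /= enormV invrK.
have m0 : 0 <= m by rewrite em mulr_ge0 ?enorm_ge0.
have {G} : forall i j, dot (side a b a' b' i) (side a b a' b' j) =
    m ^+ 2 * dot (star i) (star j).
  apply: G.
  - by rewrite /side; apply/rowP => i; rewrite !mxE; ring.
  - by rewrite /star; move: (_^-1) (_^-1) (_^-1) => u v w;
      apply/rowP => i; rewrite !mxE; ring.
  (* Both products are 1: the tangents of classes 01 and 00 at [a] are the inverses of s0 and s2. *)
  - by rewrite /= enormN !enormV (enormB b a) !mulfV ?enorm_eq0.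
move=> G.
have N p q : dot p p = m ^+ 2 * dot q q -> enorm p = m * enorm q.
  by move=> h; rewrite /enorm h sqrtrM ?sqr_ge0 // sqrtr_sqr ger0_norm.
have NS : enorm S = m * (enorm (c - a))^-1.
  rewrite enormB -enormV; apply: N.
  have -> : (a - c)^-1 = star (false, false) + star (true, true).
    by rewrite /= [RHS]addrC subrK.
  rewrite -[S]/(side a b a' b' (false, false) + side a b a' b' (true, true)).
  exact: gram_add.
have ca0 : enorm (c - a) != 0 by rewrite enormB enorm_eq0.
have s00 : enorm s0 != 0 by rewrite enormB enorm_eq0.
have s20 : enorm s2 != 0 by rewrite enorm_eq0.
have N1 : enorm s1 = m * ((enorm s0)^-1 * enorm (c - b) * (enorm (c - a))^-1).
  rewrite (enormB b a) (enormB c b) (enormB c a) -!enormV -!enormM.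
  have -> : (a - b)^-1 * (b - c) * (a - c)^-1 = star (true, false).
    by rewrite /= invqB //; congr (_ * _ * _); rewrite opprB [RHS]addrC addrA subrK.
  by apply: N; exact: (G (true, false) (true, false)).
have N3 : enorm s3 = m * ((enorm s2)^-1 * enorm (c - b') * (enorm (c - a))^-1).
  rewrite (enormB c b') (enormB c a) -!enormV -!enormM.
  have -> : (a - b')^-1 * (b' - c) * (a - c)^-1 = - star (true, true).
    by rewrite /= opprB invqB //; congr (_ * _ * _); rewrite opprB [RHS]addrC addrA subrK.
  by rewrite enormN; apply: N; exact: (G (true, true) (true, true)).
rewrite -enorm_eq0 NS N1 N3 em; split; first by rewrite !mulf_neq0 ?invr_eq0.
- by field.
- by field; rewrite ca0 s00.
- by field; rewrite ca0 s20.
Qed.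

End Gram.

(* For each class [k], the face at the vertex 14 (resp. 12, 13) whose circle
   belongs to [k] there, and the two further vertices of that face in positive
   order. *)
Definition face14 (k : bool * bool) : face := face_of true (k.1 (+) k.2) k.1.
Definition face12 (k : bool * bool) : face := face_of (k.1 (+) k.2) true k.2.
Definition face13 (k : bool * bool) : face := face_of (~~ k.1) (~~ k.2) false.

Definition pair14 (k : bool * bool) : vertex * vertex :=
  match k with
  | (false, false) => (V34, V13) | (true, false) => (V12, V24)
  | (false, true) => (V13, V12) | (true, true) => (V24, V34)
  end.

Definition pair12 (k : bool * bool) : vertex * vertex :=
  match k with
  | (false, false) => (V13, V23) | (true, false) => (V14, V13)
  | (false, true) => (V24, V14) | (true, true) => (V23, V24)
  end.

Definition pair13 (k : bool * bool) : vertex * vertex :=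
  match k with
  | (false, false) => (V12, V14) | (true, false) => (V23, V12)
  | (false, true) => (V14, V34) | (true, true) => (V34, V23)
  end.

Lemma face14P k : positive V14 (pair14 k).1 (pair14 k).2 /\
  val (face14 k) = [set V14; (pair14 k).1; (pair14 k).2]%SET.
Proof.
have p : positive V14 (pair14 k).1 (pair14 k).2 by case: k => [] [] [].
by split=> //; apply: positive_face p _ _ _; case: k => [] [] []; rewrite !inE.
Qed.

Lemma face12P k : positive V12 (pair12 k).1 (pair12 k).2 /\
  val (face12 k) = [set V12; (pair12 k).1; (pair12 k).2]%SET.
Proof.
have p : positive V12 (pair12 k).1 (pair12 k).2 by case: k => [] [] [].
by split=> //; apply: positive_face p _ _ _; case: k => [] [] []; rewrite !inE.
Qed.

Lemma face13P k : positive V13 (pair13 k).1 (pair13 k).2 /\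
  val (face13 k) = [set V13; (pair13 k).1; (pair13 k).2]%SET.
Proof.
have p : positive V13 (pair13 k).1 (pair13 k).2 by case: k => [] [] [].
by split=> //; apply: positive_face p _ _ _; case: k => [] [] []; rewrite !inE.
Qed.

Lemma corr_opposite i j k v : v \in val (face_of i j k) ->
  corr (face_of i j k, v) (face_of (~~ i) (~~ j) (~~ k), opposite v).
Proof.
move=> h; apply: corr_opp => // w; rewrite !inE.
by case: w; case: i {h}; case: j; case: k.
Qed.

Lemma corr_14_13 k : corr (face14 k, V14) (face13 k, V13).
Proof.
case: k => [] [] [].
- apply: corr_trans (corr_opposite _) _; first by rewrite !inE.
  by apply: corr_edge; rewrite ?face_of_neq //= !inE.
- apply: corr_trans (corr_opposite _) _; first by rewrite !inE.
  by apply: corr_edge; rewrite ?face_of_neq //= !inE.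
- by apply: corr_edge; rewrite ?face_of_neq //= !inE.
- by apply: corr_edge; rewrite ?face_of_neq //= !inE.
Qed.

Lemma corr_12_13 k : corr (face12 k, V12) (face13 k, V13).
Proof.
case: k => [] [] [].
- apply: corr_trans (corr_opposite _) _; first by rewrite !inE.
  by apply: corr_edge; rewrite ?face_of_neq //= !inE.
- by apply: corr_edge; rewrite ?face_of_neq //= !inE.
- apply: corr_trans (corr_opposite _) _; first by rewrite !inE.
  by apply: corr_edge; rewrite ?face_of_neq //= !inE.
- by apply: corr_edge; rewrite ?face_of_neq //= !inE.
Qed.

(* The action on the classes of exchanging 14 with 12 and 23 with 34. *)
Definition swap (k : bool * bool) : bool * bool :=
  match k with
  | (true, false) => (false, true) | (false, true) => (true, false) | _ => k
  end.

Section Stars.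
Variable R : realType.
Variables a b a' b' c : quaternion R.
Let P := inverted_points a b a' b' c.

Lemma direction_pair13 k :
  direction (P V13) (P (pair13 k).1) (P (pair13 k).2) = side a b a' b' k.
Proof. by case: k => [] [] []; apply: direction_0. Qed.

Hypotheses (a0 : a != 0) (b0 : b != 0) (a'0 : a' != 0) (b'0 : b' != 0)
  (c0 : c != 0).
Hypotheses (ab : a != b) (ab' : a != b') (ac : a != c).

Lemma direction_pair14 k :
  direction (P V14) (P (pair14 k).1) (P (pair14 k).2) = a * star a b b' c k * a.
Proof.
case: k => [] [] [].
- exact: direction_inv3.
- exact: direction_inv3.
- exact: direction_inv0l.
- exact: direction_inv0r.
Qed.

Hypotheses (ba : b != a) (ba' : b != a') (bc : b != c).

(** The case of [direction_pair14] with a, b and a', b' exchanged; the exchange reverses the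
    orientation, whence the sign and [swap]. *)
Lemma direction_pair12 k :
  direction (P V12) (P (pair12 (swap k)).1) (P (pair12 (swap k)).2) =
  - (b * star b a a' c k * b).
Proof.
rewrite -mulNr -mulrN; case: k => [] [] []; rewrite [star _ _ _ _ _]/= ?opprB ?opprK.
- exact: direction_inv3.
- exact: direction_inv3.
- exact: direction_inv0r.
- exact: direction_inv0l.
Qed.

End Stars.

Lemma side_swap (R : realType) (a b a' b' : quaternion R) k :
  side b a b' a' k = - side a b a' b' (swap k).
Proof. by case: k => [] [] [] /=; rewrite opprB. Qed.

(** * From equal angles to multi-ratio -1 *)

Section Direct.
Variable R : realType.
Implicit Types (Phi : vertex -> quaternion R) (Gamma : face -> set (quaternion R)).

(** A coherent orientation is positive on all faces or negative on all. In the second case every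
    direction changes sign, which leaves the cosines as they are. *)
Lemma cosines_of_clifford Phi Gamma (f g f' g' : face) v w x y x' y' z t z' t' :
  generalized_clifford Phi Gamma ->
  corr (f, v) (f', w) -> corr (g, v) (g', w) ->
  positive v x y /\ val f = [set v; x; y]%SET ->
  positive v x' y' /\ val g = [set v; x'; y']%SET ->
  positive w z t /\ val f' = [set w; z; t]%SET ->
  positive w z' t' /\ val g' = [set w; z'; t']%SET ->
  cosine (direction (Phi v) (Phi x) (Phi y)) (direction (Phi v) (Phi x') (Phi y')) =
  cosine (direction (Phi w) (Phi z) (Phi t)) (direction (Phi w) (Phi z') (Phi t')).
Proof.
move=> [[injP circ inc] [C [carr coh ang]]] cf cg [p1 e1] [p2 e2] [p3 e3] [p4 e4].
have := ang _ _ _ _ _ _ cf cg.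
have on v' : v' \in val (face_of true true true) ->
    carrier (C (face_of true true true)) (Phi v').
  by rewrite carr => h; apply/inc.
have [c1 c2 c3] : [/\ carrier (C (face_of true true true)) (Phi V14),
    carrier (C (face_of true true true)) (Phi V12) &
    carrier (C (face_of true true true)) (Phi V24)].
  by split; apply: on; rewrite !inE.
have [n1 n2 n3] : [/\ Phi V14 != Phi V12, Phi V14 != Phi V24 & Phi V12 != Phi V24].
  by rewrite !(inj_eq injP).
have [pT|pT] := passes_or c1 c2 c3 n1 n2 n3.
- pose T f v w x := passes (C f) (Phi v) (Phi w) (Phi x).
  have pos : forall f v w x, positive v w x -> val f = [set v; w; x]%SET -> T f v w x.
    apply: orientation_propagates => // f1 v1 w1 x1.
    exact: passes_rot.
  rewrite (circle_angleE (pos _ _ _ _ p1 e1) (pos _ _ _ _ p2 e2)).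
  rewrite (circle_angleE (pos _ _ _ _ p3 e3) (pos _ _ _ _ p4 e4)).
  exact: acos_cosine_inj.
pose T f v w x := passes (C f) (Phi v) (Phi x) (Phi w).
have pos : forall f v w x, positive v w x -> val f = [set v; w; x]%SET -> T f v w x.
  apply: orientation_propagates => // [f1 v1 w1 x1 h|]; rewrite /T.
    by do 2!apply: passes_rot.
  move=> f1 g1 v1 w1 a b n ef eg /passes_rot/passes_rot h.
  apply: passes_rot; apply: coh h; first exact: n.
    by rewrite ef (finset.setUC [set v1]%SET).
  by rewrite eg (finset.setUC [set v1]%SET).
rewrite (circle_angleE (pos _ _ _ _ p1 e1) (pos _ _ _ _ p2 e2)).
rewrite (circle_angleE (pos _ _ _ _ p3 e3) (pos _ _ _ _ p4 e4)).
move=> /acos_cosine_inj.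
rewrite (directionC _ (Phi x)) (directionC _ (Phi x')).
by rewrite (directionC _ (Phi z)) (directionC _ (Phi z')) !cosineN.
Qed.

(** A linear relation with l nonzero would put the image of [u] under inversion at [v] on the line
    of the circle, hence [u] on the circle, against the incidences. *)
Lemma non_cocyclic Phi Gamma (f : face) v w x u :
  octahedral_configuration Phi Gamma ->
  val f = [set v; w; x]%SET -> v != w -> v != x -> w != x -> u \notin val f ->
  forall k l : R, k *: direction (Phi v) (Phi w) (Phi x) +
    l *: direction (Phi v) (Phi x) (Phi u) = 0 -> k = 0 /\ l = 0.
Proof.
move=> conf ef vw vx wx uf k l h; have [injP circ inc] := conf.
have [C eC pC] : exists2 C, carrier C = Gamma f & passes C (Phi v) (Phi w) (Phi x).
  by apply: (oriented_circle conf ef); rewrite // eq_sym.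
have d0 : direction (Phi v) (Phi w) (Phi x) != 0.
  by apply: direction_neq0; rewrite (inj_eq injP).
have l0 : l = 0.
  have uv : u != v by apply: contra uf => /eqP ->; rewrite ef !inE eqxx.
  apply/eqP; apply: contraNT uf => l0; apply/inc; rewrite -eC.
  (* The relation k (W - X) + l (X - U) = 0 solved for U, starting from W. *)
  apply: (carrier_of_direction (m := k / l - 1) pC); rewrite ?(inj_eq injP) //.
  move: h; rewrite /direction; move: (_^-1) (_^-1) (_^-1) => W X U h.
  apply/rowP => i; have := congr1 (fun M : 'rV[R]_4 => M 0 i) h.
  rewrite !mxE => hi; apply: (mulfI l0); apply: subr0_eq.
  by rewrite -[RHS]oppr0 -hi; field.
split=> //; apply/eqP; move/eqP: h; rewrite l0 scale0r addr0 scaler_eq0.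
by rewrite (negPf d0) orbF.
Qed.

Theorem multiratio_of_clifford Phi Gamma : generalized_clifford Phi Gamma ->
  multiratio (Phi V14) (Phi V12) (Phi V24) (Phi V23) (Phi V34) (Phi V13) = - qone \/
  multiratio_tilde (Phi V14) (Phi V12) (Phi V24) (Phi V23) (Phi V34) (Phi V13) = - qone.
Proof.
move=> cliff; have [conf _] := cliff; have [injP _ _] := conf.
pose Q v := (Phi v - Phi V13)^-1.
have QK v : Phi v - Phi V13 = (Q v)^-1 by rewrite invrK.
pose a := Q V14; pose b := Q V12; pose a' := Q V23; pose b' := Q V34; pose c := Q V24.
have [a0 b0 a'0 b'0 c0] : [/\ a != 0, b != 0, a' != 0, b' != 0 & c != 0].
  by split; rewrite invq_eq0 subr_eq0 (inj_eq injP).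
have Qn v w : v != w -> Q v != Q w.
  by apply: contra_neq => /invr_inj /addIr; apply: injP.
have [ab ba' a'b' ab'] : [/\ a != b, b != a', a' != b' & a != b'].
  by split; apply: Qn.
have [ac bc a'c b'c] : [/\ a != c, b != c, a' != c & b' != c].
  by split; apply: Qn.
have ba : b != a by rewrite eq_sym.
have dirE v w x : direction (Phi v) (Phi w) (Phi x) =
    direction (Phi v - Phi V13) (Phi w - Phi V13) (Phi x - Phi V13).
  by rewrite direction_translate.
have P0 : Phi V13 - Phi V13 = 0 by rewrite subrr.
have ip u : Phi u - Phi V13 = inverted_points a b a' b' c u.
  by case: u; rewrite /= ?P0 ?QK.
clearbody a b a' b' c.
have dir13 k : direction (Phi V13) (Phi (pair13 k).1) (Phi (pair13 k).2) =
    side a b a' b' k by rewrite dirE !ip direction_pair13.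
have dir14 k : direction (Phi V14) (Phi (pair14 k).1) (Phi (pair14 k).2) =
    a * star a b b' c k * a by rewrite dirE !ip direction_pair14.
have dir12 k : direction (Phi V12) (Phi (pair12 (swap k)).1) (Phi (pair12 (swap k)).2) =
    - (b * star b a a' c k * b) by rewrite dirE !ip direction_pair12.
have cs14 i j : cosine (star a b b' c i) (star a b b' c j) =
    cosine (side a b a' b' i) (side a b a' b' j).
  rewrite -(cosineM _ _ a0 a0) -!dir14 -!dir13.
  exact: (cosines_of_clifford cliff (corr_14_13 i) (corr_14_13 j)
    (face14P i) (face14P j) (face13P i) (face13P j)).
have cs12 i j : cosine (star b a a' c i) (star b a a' c j) =
    cosine (side b a b' a' i) (side b a b' a' j).
  rewrite !(side_swap a b a' b') cosineN -(cosineM _ _ b0 b0) -cosineN -!dir12 -!dir13.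
  exact: (cosines_of_clifford cliff (corr_12_13 _) (corr_12_13 _)
    (face12P _) (face12P _) (face13P _) (face13P _)).
have pull (x y z : quaternion R) (k l : R) :
    k *: (x * y * x) + l *: (x * z * x) = x * (k *: y + l *: z) * x.
  by rewrite mulrDr mulrDl -!scaleqAr -!scaleqAl.
have ind14 (k l : R) :
    k *: star a b b' c (true, false) + l *: star a b b' c (true, true) = 0 ->
    k = 0 /\ l = 0.
  move=> h.
  apply: (@non_cocyclic Phi Gamma (face_of true true true) V14 V12 V24 V34) => //.
    by rewrite !inE.
  rewrite [direction _ _ _](dir14 (true, false)) [X in _ + l *: X](dir14 (true, true)).
  by rewrite pull h mulr0 mul0r.
have ind12 (k l : R) :
    k *: star b a a' c (true, false) + l *: star b a a' c (true, true) = 0 ->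
    k = 0 /\ l = 0.
  move=> h.
  apply: (@non_cocyclic Phi Gamma (face_of true true true) V12 V14 V24 V23) => //.
  - by rewrite (finset.setUC [set V12]%SET).
  - by rewrite !inE.
  have d1 : direction (Phi V12) (Phi V14) (Phi V24) =
      b * star b a a' c (true, false) * b.
    by rewrite directionC; apply: canLR opprK _; apply: (dir12 (true, false)).
  have d2 : direction (Phi V12) (Phi V24) (Phi V23) =
      b * star b a a' c (true, true) * b.
    by rewrite directionC; apply: canLR opprK _; apply: (dir12 (true, true)).
  by rewrite d1 d2 pull h mulr0 mul0r.
(* Vertex 14 gives the distances from [c] to a, b, b'; the one to a' comes from vertex 12, where S
   only changes sign. *)
have [S0 da db db'] := distances_of_angles ab ab' ac bc b'c cs14 ind14.
have [_ _ _ da'] := distances_of_angles ba ba' bc ac a'c cs12 ind12.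
have ca : c - a = - ((a - b') * (b - a + (b' - a'))^-1 * (b - a)) \/
    c - a = - ((b - a) * (b - a + (b' - a'))^-1 * (a - b')).
  apply: (fifth_point S0 da db _ db'); rewrite (enormB b' a') (enormB a' b).
  by rewrite -[enorm (b - a + _)]enormN opprD (opprB b a) (opprB b' a').
have nc (x y : quaternion R) : x != y -> qconj x != qconj y.
  by rewrite (inj_eq (can_inj (@qconjK R))).
have n0 (x : quaternion R) : x != 0 -> qconj x != 0.
  by rewrite -!dot_eq0 dot_conj.
case: ca => ca; [left | right].
  rewrite -(multiratio_translate (Phi V13)) !ip.
  exact: (multiratio_normal_form a0 b0 a'0 b'0 c0 ab ba' a'b' bc S0 ca).
rewrite multiratio_tilde_conj -(multiratio_translate (qconj (Phi V13))) -!qconjB !ip.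
rewrite /inverted_points -!qinvE !qconjV !qinvE.
(* Conjugation typed into the ring, so that its rules rewrite ring expressions. It turns the second
   position of [c] into the first one for the conjugate points. *)
pose k (x : quaternion R) : quaternion R := qconj x.
have kB x y : k (x - y) = k x - k y by apply: qconjB.
have kD x y : k (x + y) = k x + k y by apply: qconjD.
have kN x : k (- x) = - k x by apply: qconjN.
have kM x y : k (x * y) = k y * k x by apply: qconjM.
have kV x : k x^-1 = (k x)^-1 by apply: qconjV.
have S0' : k b - k a + (k b' - k a') != 0 by rewrite -!kB -kD n0.
have caC : k c - k a =
    - ((k a - k b') * (k b - k a + (k b' - k a'))^-1 * (k b - k a)).
  by rewrite -!kB -kD ca kN !kM kV mulrA.
rewrite qconj0 -[RHS]qconj_opp1; congr qconj.
exact: (multiratio_normal_form (n0 _ a0) (n0 _ b0) (n0 _ a'0) (n0 _ b'0) (n0 _ c0)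
  (nc _ _ ab) (nc _ _ ba') (nc _ _ a'b') (nc _ _ bc) S0' caC).
Qed.
End Direct.

Theorem theorem6p3 (R : realType) :
  (forall (Phi : vertex -> 'rV[R]_4) (Gamma : face -> set 'rV[R]_4),
     generalized_clifford Phi Gamma ->
     multiratio (Phi V14) (Phi V12) (Phi V24) (Phi V23) (Phi V34) (Phi V13)
       = - qone
     \/ multiratio_tilde
          (Phi V14) (Phi V12) (Phi V24) (Phi V23) (Phi V34) (Phi V13)
       = - qone)
  /\
  (forall (Phi : vertex -> 'rV[R]_4) (Gamma : face -> set 'rV[R]_4),
     octahedral_configuration Phi Gamma ->
     multiratio (Phi V14) (Phi V12) (Phi V24) (Phi V23) (Phi V34) (Phi V13)
       = - qone
     \/ multiratio_tilde
          (Phi V14) (Phi V12) (Phi V24) (Phi V23) (Phi V34) (Phi V13)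
       = - qone ->
     generalized_clifford Phi Gamma).
Proof.
split=> Phi Gamma; first exact: multiratio_of_clifford.
exact: clifford_of_multiratio.
Qed.
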